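(* For every $\mathfrak{h}\ge1$ such that level $\mathfrak{h}$ of the hierarchy is defined, $\nu_{\mathfrak{h}}<\nu_{\mathfrak{h}-1}$. In particular, the construction terminates: there is a finite terminal level $\mathfrak{m}\ge1$ with $\nu_{\mathfrak{m}-1}>1$ and $\nu_{\mathfrak{m}}=1$.
   Context: Setting. Let $\Omega$ be a finite set with a connected undirected graph structure; write $\eta\sim\xi$ if $\{\eta,\xi\}$ is an edge. Let $\mathbb{H}:\Omega\to\mathbb{R}$. Paths and heights. A path $\omega:\eta\to\xi$ is a sequence $(\omega_n)_{n=0}^N$ with $\omega_0=\eta$, $\omega_N=\xi$ and $\omega_n\sim\omega_{n+1}$ ($N=0$ allowed). Its height is $\Phi_\omega:=\max_n\mathbb{H}(\omega_n)$. Set $\Phi(\eta,\xi):=\min_{\omega:\eta\to\xi}\Phi_\omega$. For nonempty sets, $\Phi(\mathcal{A},\mathcal{B}):=\min_{\eta\in\mathcal{A},\xi\in\mathcal{B}}\Phi(\eta,\xi)$, and $\Phi(\mathcal{A},\eta):=\Phi(\mathcal{A},\{\eta\})$. Ground states. $\mathcal{S}:=\operatorname{argmin}_\Omega\mathbb{H}$, $\overline{\Phi}:=\max_{s,s'\in\mathcal{S}}\Phi(s,s')$, and $\overline{\Omega}:=\{\eta:\Phi(\mathcal{S},\eta)\le\overline{\Phi}\}$. Sets. For $\mathcal{A}\subseteq\Omega$: $\mathcal{F}(\mathcal{A}):=\operatorname{argmin}_{\mathcal{A}}\mathbb{H}$; $\partial\mathcal{A}:=\{\eta\notin\mathcal{A}:\eta\sim\xi\text{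 for some }\xi\in\mathcal{A}\}$; $\partial^\star\mathcal{A}:=\mathcal{F}(\partial\mathcal{A})$. A set is connected if any two of its points are joined by a path inside it. Stable plateaux and cycles. A stable plateau is a nonempty connected set $\mathcal{P}$ with constant energy $\mathbb{H}(\mathcal{P})$ such that $\mathbb{H}>\mathbb{H}(\mathcal{P})$ on $\partial\mathcal{P}$. A cycle is a nonempty connected $\mathcal{C}$ with $\max_{\mathcal{C}}\mathbb{H}<\min_{\partial\mathcal{C}}\mathbb{H}$. Its depth is $\Gamma^{\mathcal{C}}:=\min_{\partial\mathcal{C}}\mathbb{H}-\min_{\mathcal{C}}\mathbb{H}$. General construction (C). Let $\mathscr{C}$ be a collection of pairwise disjoint cycles contained in $\overline{\Omega}$ with $|\mathscr{C}|\ge2$, and let $\Gamma^\star>0$. Put - $\mathscr{C}^\star:=\{\mathcal{C}\in\mathscr{C}:\Gamma^{\mathcal{C}}\ge\Gamma^\star\}$ and $\mathscr{C}^\sharp:=\{\mathcal{C}\in\mathscr{C}:\Gamma^{\mathcal{C}}<\Gamma^\star\}$; - $\mathscr{P}^{\mathscr{C}}:=\{\mathcal{F}(\mathcal{C}):\mathcal{C}\in\mathscr{C}\}$ and $\mathscr{P}^{\mathscr{C}^\star}:=\{\mathcal{F}(\mathcal{C}):\mathcal{C}\in\mathscr{C}^\star\}$; - $\Delta^{\mathscr{C}}:=\overline{\Omega}\setminus\bigcup_{\mathcal{C}\in\mathscr{C}}\mathcal{C}$. Let $\mathfrak{X}^{\mathscr{C}}$ be the continuous-time Markov chain on $\Omega^{\mathscr{C}}:=\Delta^{\mathscr{C}}\cup\mathscr{P}^{\mathscr{C}}$,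 in which each $\mathcal{F}(\mathcal{C})$ is treated as a single point. Its rates are: - $\mathfrak{R}^{\mathscr{C}}(\eta,\xi)=1$ for $\eta,\xi\in\Delta^{\mathscr{C}}$ with $\eta\sim\xi$ and $\mathbb{H}(\xi)\le\mathbb{H}(\eta)$; - $\mathfrak{R}^{\mathscr{C}}(\eta,\mathcal{F}(\mathcal{C}))=|\{\zeta\in\mathcal{C}:\eta\sim\zeta\}|$ for $\eta\in\Delta^{\mathscr{C}}\cap\partial\mathcal{C}$; - $\mathfrak{R}^{\mathscr{C}}(\mathcal{F}(\mathcal{C}),\eta)=|\mathcal{F}(\mathcal{C})|^{-1}|\{\zeta\in\mathcal{C}:\eta\sim\zeta\}|$ if $\Gamma^{\mathcal{C}}\le\Gamma^\star$ and $\eta\in\partial^\star\mathcal{C}$; - all other rates are $0$. The trace chain $\mathfrak{X}^{\mathscr{C}^\star}$ on $\mathscr{P}^{\mathscr{C}^\star}$ has rates, for distinct $\mathcal{C},\mathcal{C}'\in\mathscr{C}^\star$, $$\mathfrak{R}^{\mathscr{C}^\star}(\mathcal{F}(\mathcal{C}),\mathcal{F}(\mathcal{C}')):=\sum_{\eta\in\Delta^{\mathscr{C}}}\mathfrak{R}^{\mathscr{C}}(\mathcal{F}(\mathcal{C}),\eta)\,\mathbf{P}^{\mathscr{C}}_\eta[\mathcal{T}_{\mathcal{F}(\mathcal{C}')}=\mathcal{T}_{\mathscr{P}^{\mathscr{C}^\star}}].$$ Here $\mathbf{P}^{\mathscr{C}}_\eta$ is the law of $\mathfrak{X}^{\mathscr{C}}$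 started at $\eta$, and $\mathcal{T}_{\mathcal{A}}$ is the hitting time of $\mathcal{A}$. Hierarchy. Let $\mathscr{P}^1=\{\mathcal{P}_1^1,\dots,\mathcal{P}^1_{\nu_0}\}$ be the collection of all stable plateaux contained in $\overline{\Omega}$, and assume $\nu_0\ge2$. Suppose that at some level $\mathfrak{h}\ge1$ the sets $\mathcal{P}^{\mathfrak{h}}_1,\dots,\mathcal{P}^{\mathfrak{h}}_{\nu_{\mathfrak{h}-1}}$ are defined, with $\nu_{\mathfrak{h}-1}\ge2$. Then define: - $\mathbb{H}(\mathcal{P}^{\mathfrak{h}}_i):=\min_{\mathcal{P}^{\mathfrak{h}}_i}\mathbb{H}$; - $\mathscr{P}^{\star,\mathfrak{h}}:=\{\mathcal{P}^{\mathfrak{h}}_i:i\in[1,\nu_{\mathfrak{h}-1}]\}$; - $\breve{\mathcal{P}}^{\mathfrak{h}}_i:=\bigcup_{j\ne i}\mathcal{P}^{\mathfrak{h}}_j$; - $\Gamma^{\mathfrak{h}}_i:=\Phi(\mathcal{P}^{\mathfrak{h}}_i,\breve{\mathcal{P}}^{\mathfrak{h}}_i)-\mathbb{H}(\mathcal{P}^{\mathfrak{h}}_i)$ and $\Gamma^{\star,\mathfrak{h}}:=\min_i\Gamma_i^{\mathfrak{h}}$; - $\mathcal{V}^{\mathfrak{h}}_i:=\{\eta\in\Omega:\Phi(\mathcal{P}^{\mathfrak{h}}_i,\eta)-\mathbb{H}(\mathcal{P}^{\mathfrak{h}}_i)<\Gamma^{\mathfrak{h}}_i\}$. Set $\mathscr{C}^1:=\{\mathcal{V}^1_i:i\in[1,\nu_0]\}$.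 For $\mathfrak{h}\ge2$, set $$\mathscr{C}^{\mathfrak{h}}:=\{\mathcal{V}^{\mathfrak{h}}_i:i\in[1,\nu_{\mathfrak{h}-1}]\}\cup\{\mathcal{C}\in\mathscr{C}^{\star,\mathfrak{h}-1}_{\rm tr}\cup\mathscr{C}^{\sharp,\mathfrak{h}-1}:\mathcal{C}\cap\mathcal{V}^{\mathfrak{h}}_i=\emptyset\ \forall i\}.$$ Apply (C) to $(\mathscr{C}^{\mathfrak{h}},\Gamma^{\star,\mathfrak{h}})$. Write $\mathscr{C}^{\star,\mathfrak{h}}:=(\mathscr{C}^{\mathfrak{h}})^\star$ and $\mathscr{C}^{\sharp,\mathfrak{h}}:=(\mathscr{C}^{\mathfrak{h}})^\sharp$. Let $\mathfrak{X}^{\star,\mathfrak{h}}$ be the trace chain of (C) on $\mathscr{P}^{(\mathscr{C}^{\mathfrak{h}})^\star}$. Decompose $\mathscr{P}^{(\mathscr{C}^{\mathfrak{h}})^\star}$ into the closed communicating classes $\mathscr{P}^{\star,\mathfrak{h}}_1,\dots,\mathscr{P}^{\star,\mathfrak{h}}_{\nu_{\mathfrak{h}}}$ of $\mathfrak{X}^{\star,\mathfrak{h}}$ and the set $\mathscr{P}^{\star,\mathfrak{h}}_{\rm tr}$ of transient elements. Let $\mathscr{C}^{\star,\mathfrak{h}}_m:=\{\mathcal{C}\in\mathscr{C}^{\star,\mathfrak{h}}:\mathcal{F}(\mathcal{C})\in\mathscr{P}^{\star,\mathfrak{h}}_m\}$ for $m\in\{1,\dots,\nu_{\mathfrak{h}},{\rm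 tr}\}$. If $\nu_{\mathfrak{h}}\ge2$, define $\mathcal{P}^{\mathfrak{h}+1}_i:=\bigcup_{\mathcal{P}\in\mathscr{P}^{\star,\mathfrak{h}}_i}\mathcal{P}$ for $i\in[1,\nu_{\mathfrak{h}}]$ and continue to level $\mathfrak{h}+1$. The terminal level $\mathfrak{m}$ is the first $\mathfrak{h}$ with $\nu_{\mathfrak{h}}=1$. Finally, $\mathscr{P}^{\star,\mathfrak{h}}_{\rm rec}:=\mathscr{P}^{\star,\mathfrak{h}}_1\cup\dots\cup\mathscr{P}^{\star,\mathfrak{h}}_{\nu_{\mathfrak{h}}}$. Here $[a,b]$ denotes the set of integers from $a$ to $b$. *)

(* Defs.v *)
From HB Require Import structures.
From mathcomp Require Import all_boot all_order all_algebra.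
From mathcomp Require Import all_classical all_reals all_analysis.
Set Implicit Arguments. Unset Strict Implicit. Unset Printing Implicit Defensive.
Import Order.TTheory GRing.Theory Num.Theory.
Local Open Scope ring_scope.

Section Hierarchy.
Variables (R : realType) (T : finType) (e : rel T) (H : T -> R).

(* minimum / maximum of f over a finite set A (A nonempty in all uses;
   the value 0 for an empty A is an irrelevant default) *)
Definition minOver (U : finType) (A : {set U}) (f : U -> R) : R :=
  if [pick x in A] is Some x0 then \big[Num.min/f x0]_(x in A) f x else 0.
Definition maxOver (U : finType) (A : {set U}) (f : U -> R) : R :=
  if [pick x in A] is Some x0 then \big[Num.max/f x0]_(x in A) f x else 0.

Definition pathLe (eta xi : T) (c : R) : bool :=
  (H eta <= c) && connect (fun x y => e x y && (H y <= c)) eta xi.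

(* Phi(eta, xi) = min over paths of the path height; the height of a path
   is a value of H, so this is the least value H z which bounds some path *)
Definition Phi (eta xi : T) : R := minOver [set z | pathLe eta xi (H z)] H.
Definition PhiSet (A B : {set T}) : R :=
  minOver A (fun x => minOver B (fun y => Phi x y)).

Definition groundStates : {set T} := [set x | [forall y, H x <= H y]].
Definition PhiBar : R :=
  maxOver (finset.setX groundStates groundStates) (fun p => Phi p.1 p.2).
Definition OmegaBar : {set T} := [set eta | PhiSet groundStates [set eta] <= PhiBar].

Definition Fmin (A : {set T}) : {set T} := [set x in A | [forall y in A, H x <= H y]].
Definition bdry (A : {set T}) : {set T} := [set y | (y \notin A) && [exists x in A, e y x]].
Definition bdryStar (A : {set T}) : {set T} := Fmin (bdry A).
Definition connectedSet (A : {set T}) : bool :=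
  [forall x in A, forall y in A, connect (fun u v => e u v && (v \in A)) x y].

Definition stablePlateau (P : {set T}) : bool :=
  [&& P != finset.set0, connectedSet P,
      [forall x in P, forall y in P, H x == H y] &
      [forall x in P, forall y in bdry P, H x < H y]].
Definition isCycle (C : {set T}) : bool :=
  [&& C != finset.set0, connectedSet C & [forall x in C, forall y in bdry C, H x < H y]].
Definition depth (C : {set T}) : R := minOver (bdry C) H - minOver C H.

Section Construction.
Variables (Cs : {set {set T}}) (GamStar : R).

Definition Cstar : {set {set T}} := [set C in Cs | GamStar <= depth C].
Definition Csharp : {set {set T}} := [set C in Cs | depth C < GamStar].
Definition Delta : {set T} := OmegaBar :\: \bigcup_(C in Cs) C.

(* states: inl eta for eta in Delta, inr C for the collapsed point F(C), C in Cs *)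
Definition St := (T + {set T})%type.

Definition rate (x y : St) : R :=
  match x, y with
  | inl a, inl b => if [&& a \in Delta, b \in Delta, e a b & H b <= H a] then 1 else 0
  | inl a, inr C => if [&& a \in Delta, C \in Cs & a \in bdry C]
                    then #|[set z in C | e a z]|%:R else 0
  | inr C, inl b => if [&& C \in Cs, b \in Delta, depth C <= GamStar & b \in bdryStar C]
                    then (#|Fmin C|%:R)^-1 * #|[set z in C | e b z]|%:R else 0
  | inr _, inr _ => 0
  end.

(* embedded jump chain of the continuous-time chain *)
Definition outRate (x : St) : R := \sum_(y | y != x) rate x y.
Definition jump (x y : St) : R :=
  if outRate x == 0 then (x == y)%:R
  else if y == x then 0 else rate x y / outRate x.

Fixpoint hitWithin (A : {set St}) (a : St) (n : nat) (x : St) : R :=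
  if x \in A then (x == a)%:R
  else if n is n'.+1 then \sum_y jump x y * hitWithin A a n' y else 0.
(* P_x[ T_a = T_A < infinity ] *)
Definition hitProb (A : {set St}) (a : St) (x : St) : R :=
  limn (fun n : nat => hitWithin A a n x : R^o).

Definition PstarStates : {set St} := [set inr C | C in Cstar].

Definition traceRate (C C' : {set T}) : R :=
  \sum_(eta in Delta) rate (inr C) (inl eta) * hitProb PstarStates (inr C') (inl eta).

Definition traceEdge (C C' : {set T}) : bool :=
  [&& C \in Cstar, C' \in Cstar, C != C' & 0 < traceRate C C'].
Definition reach (C C' : {set T}) : bool := connect traceEdge C C'.

Definition closedClasses : {set {set {set T}}} :=
  [set K | [exists C in Cstar,
     (K == [set C' | reach C C']) && [forall C' in K, reach C' C]]].
Definition Ctr : {set {set T}} := [set C in Cstar | [forall K in closedClasses, C \notin K]].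
End Construction.

Definition P1 : {set {set T}} := [set P | stablePlateau P && (P \subset OmegaBar)].

Section Level.
Variables (Ps : {set {set T}}) (L : {set {set T}}).
(* Ps = {P^h_i}, L = C^{*,h-1}_tr \cup C^{#,h-1} (empty at level 1) *)
Definition HP (P : {set T}) : R := minOver P H.
Definition Pbreve (P : {set T}) : {set T} := \bigcup_(Q in Ps | Q != P) Q.
Definition Gam (P : {set T}) : R := PhiSet P (Pbreve P) - HP P.
Definition GamStarLvl : R := minOver Ps Gam.
Definition Vset (P : {set T}) : {set T} := [set eta | PhiSet P [set eta] - HP P < Gam P].
Definition CsLvl : {set {set T}} :=
  [set Vset P | P in Ps] :|: [set C in L | [forall P in Ps, C :&: Vset P == finset.set0]].
Definition classesLvl := closedClasses CsLvl GamStarLvl.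
Definition nextPs : {set {set T}} := (fun K : {set {set T}} => \bigcup_(C in K) Fmin C) @: classesLvl.
Definition nextL : {set {set T}} := Ctr CsLvl GamStarLvl :|: Csharp CsLvl GamStarLvl.
End Level.

Definition step (d : {set {set T}} * {set {set T}}) := (nextPs d.1 d.2, nextL d.1 d.2).
(* lvl h = data (P^{h+1}, L^{h+1}) of level h+1 *)
Definition lvl (h : nat) := iter h step (P1, finset.set0).
Definition nu (h : nat) : nat :=
  if h is h'.+1 then #|classesLvl (lvl h').1 (lvl h').2| else #|P1|.
End Hierarchy.

(* Main.v *)
Require Import Defs.
From HB Require Import structures.
From mathcomp Require Import all_boot all_order all_algebra.
From mathcomp Require Import all_classical all_reals all_analysis.
From mathcomp Require Import finset.
Set Implicit Arguments. Unset Strict Implicit. Unset Printing Implicit Defensive.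
Import Order.TTheory GRing.Theory Num.Theory.
Local Open Scope ring_scope.

(** The chain of construction (C) only sees energy barriers.  Give a point of Delta its energy
as level, and a collapsed cycle the minimal energy of its boundary: the level never increases
along the chain, and a walk of the chain yields a landscape path that stays below its initial
level.  Conversely the chain can imitate any landscape path that stays below the escape level of
its starting cycle, unless it first drops strictly below that level or enters a cycle of depth
greater than Gamma^*.  Hence the chain always reaches a star cycle, and any path leaving a closed
class towards another one climbs more than Gamma^* above the common bottom of the class.

This propagates an invariant through the levels: the valleys V_i are disjoint cycles of depth
Gamma_i with bottom energy H(P_i), all remaining cycles have depth less than Gamma^*, and every
stable plateau lies in some cycle.  So the star cycles of a level are exactly its valleys, one per
set P_i; a valley of minimal depth Gamma^* reaches another one, so two valleys share a closed
class or one of them is transient, and there are strictly fewer classes than valleys. *)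

(** Forward induction along a walk; it is the form in which all walks below are handled, with
    conjunctions carried by [P] where needed. *)
Lemma connect_invariant (S : finType) (r : rel S) (P : S -> Prop) x y :
  P x -> (forall z w, P z -> r z w -> P w) -> connect r x y -> P y.
Proof.
move=> Px step /connectP[p]; elim: p x Px => [|z p IH] x Px /= => [_ -> //|].
by case/andP=> rxz; apply: IH; apply: step rxz.
Qed.

(** * Minima and maxima over finite sets *)

Section FiniteExtrema.
Variables (R : realType) (U : finType) (A : {set U}).
Implicit Types f : U -> R.

Lemma minOver_le f x : x \in A -> minOver A f <= f x.
Proof.
move=> xA; rewrite /minOver; case: pickP => [x0 _|/(_ x)]; last by rewrite xA.
exact: bigmin_le_cond.
Qed.

(** The fold is seeded with the value of a picked element of [A], so every intermediate value is
    attained in [A]. *)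
Lemma minOver_mem f x : x \in A -> exists2 y, y \in A & minOver A f = f y.
Proof.
move=> xA; rewrite /minOver; case: pickP => [x0 x0A|/(_ x)]; last by rewrite xA.
apply: (big_ind (fun v => exists2 y, y \in A & v = f y)) => [|u v [y yA ->] [z zA ->]|i iA].
- by exists x0.
- by rewrite minEle; case: ifP => _; [exists y|exists z].
- by exists i.
Qed.

Lemma minOver_leP f c x : x \in A ->
  reflect (exists2 y, y \in A & f y <= c) (minOver A f <= c).
Proof.
move=> xA; apply: (iffP idP) => [|[y yA]]; last exact/le_trans/minOver_le.
by have [y yA ->] := minOver_mem f xA => ?; exists y.
Qed.

Lemma le_maxOver f x : x \in A -> f x <= maxOver A f.
Proof.
move=> xA; rewrite /maxOver; case: pickP => [x0 _|/(_ x)]; last by rewrite xA.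
exact: le_bigmax_cond.
Qed.

Lemma maxOver_mem f x : x \in A -> exists2 y, y \in A & maxOver A f = f y.
Proof.
move=> xA; rewrite /maxOver; case: pickP => [x0 x0A|/(_ x)]; last by rewrite xA.
apply: (big_ind (fun v => exists2 y, y \in A & v = f y)) => [|u v [y yA ->] [z zA ->]|i iA].
- by exists x0.
- by rewrite maxEle; case: ifP => _; [exists z|exists y].
- by exists i.
Qed.

End FiniteExtrema.

(** * Energy landscapes *)

Section Landscape.
Variables (R : realType) (T : finType) (e : rel T) (H : T -> R).
Hypothesis e_sym : symmetric e.
Hypothesis e_conn : forall x y : T, connect e x y.

Local Notation pathLe := (pathLe e H).
Local Notation Phi := (Phi e H).
Local Notation PhiSet := (PhiSet e H).
Local Notation OmegaBar := (OmegaBar e H).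
Local Notation bdry := (bdry e).
Local Notation PhiBar := (PhiBar e H).

Lemma pathLe_refl x c : H x <= c -> pathLe x x c.
Proof. by rewrite /Defs.pathLe => ->; exact: connect0. Qed.

(** The relation inside [pathLe] bounds only the head of each edge, so the bound on the tail is
    carried along in the induction. *)
Lemma pathLe_ind (P : T -> Prop) x y c :
  P x -> (forall z w, P z -> H z <= c -> e z w -> H w <= c -> P w) ->
  pathLe x y c -> P y.
Proof.
move=> Px step /andP[Hx].
move=> /(connect_invariant (P := fun z => P z /\ H z <= c)) [] // z w [Pz Hz] /andP[ezw Hw].
by split=> //; apply: step ezw Hw.
Qed.

Lemma pathLe_l x y c : pathLe x y c -> H x <= c.
Proof. by case/andP. Qed.

Lemma pathLe_r x y c : pathLe x y c -> H y <= c.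
Proof. by move=> xy; apply: (pathLe_ind (P := fun z => H z <= c)) (xy) => //; exact: pathLe_l xy. Qed.

Lemma pathLe_trans y x z c : pathLe x y c -> pathLe y z c -> pathLe x z c.
Proof. by move=> /andP[Hx xy] /andP[_ yz]; rewrite /Defs.pathLe Hx (connect_trans xy yz). Qed.

Lemma pathLe_edge x y c : H x <= c -> e x y -> H y <= c -> pathLe x y c.
Proof. by move=> Hx exy Hy; rewrite /Defs.pathLe Hx connect1 // exy. Qed.

Lemma pathLe_sym x y c : pathLe x y c -> pathLe y x c.
Proof.
move=> xy; apply: (pathLe_ind (P := fun z => pathLe z x c)) (xy).
  exact/pathLe_refl/(pathLe_l xy).
move=> z w zx Hz ezw Hw; apply: pathLe_trans zx; apply: pathLe_edge => //.
by rewrite e_sym.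
Qed.

Lemma pathLe_mono x y c c' : c <= c' -> pathLe x y c -> pathLe x y c'.
Proof.
move=> cc' xy; apply: (pathLe_ind (P := fun z => pathLe x z c')) (xy).
  exact/pathLe_refl/(le_trans (pathLe_l xy)).
move=> z w xz Hz ezw Hw; apply: pathLe_trans xz _; apply: pathLe_edge => //.
  exact: le_trans cc'.
exact: le_trans cc'.
Qed.

(** The first vertex of the path outside [A] is such a [w]. *)
Lemma pathLe_exit (A : {set T}) x y c : x \in A -> y \notin A -> pathLe x y c ->
  exists2 w, w \in bdry A & H w <= c.
Proof.
move=> xA yA xy.
have : y \in A \/ exists2 w, w \in bdry A & H w <= c.
  apply: (pathLe_ind (P := fun y => y \in A \/ exists2 w, w \in bdry A & H w <= c)) (xy); first by left.
  move=> z w [zA|] Hz ezw Hw; last by right.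
  have [wA|wA] := boolP (w \in A); [by left|right; exists w => //].
  by rewrite inE wA; apply/existsP; exists z; rewrite zA e_sym.
by case=> //; rewrite (negPf yA).
Qed.

(** A highest point of the landscape bounds every path. Hence the minimum defining [Phi] is over a
    nonempty set and its default value never occurs. *)
Lemma ex_pathLe x y : exists z, pathLe x y (H z).
Proof.
have [z _ zE] := maxOver_mem H (finset.in_setT x).
have le_z w : H w <= H z by rewrite -zE le_maxOver// in_setT.
exists z; rewrite /Defs.pathLe le_z /=.
by rewrite (eq_connect (e' := e)) // => u v; rewrite le_z andbT.
Qed.

Lemma Phi_le x y c : (Phi x y <= c) = pathLe x y c.
Proof.
have [z xyz] := ex_pathLe x y.
have zin : z \in [set z | pathLe x y (H z)] by rewrite inE.
apply/idP/idP => [/(minOver_leP _ _ zin)[w]|xy].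
  by rewrite inE => xyw /pathLe_mono; apply.
(* [Phi] only ranges over values of [H], so [c] is lowered to the largest energy not exceeding it;
   the same paths remain admissible. *)
have xin : x \in [set w | H w <= c] by rewrite inE (pathLe_l xy).
have [w] := maxOver_mem H xin; rewrite inE => wc wE.
have le_w v : H v <= c -> H v <= H w by move=> vc; rewrite -wE le_maxOver // inE.
apply/(minOver_leP _ _ zin); exists w => //; rewrite inE.
apply: (pathLe_ind (P := fun v => pathLe x v (H w))) (xy).
  exact/pathLe_refl/le_w/(pathLe_l xy).
move=> u v xu Hu euv Hv; apply: pathLe_trans xu _.
by apply: pathLe_edge => //; exact: le_w.
Qed.

Lemma PhiSet_leP (A B : {set T}) c x y : x \in A -> y \in B ->
  reflect (exists x y, [/\ x \in A, y \in B & pathLe x y c]) (PhiSet A B <= c).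
Proof.
move=> xA yB; apply: (iffP (minOver_leP _ _ xA)) => [[u uA]|[u [v [uA vB uv]]]].
  by move=> /(minOver_leP _ _ yB)[v vB]; rewrite Phi_le => uv; exists u, v.
by exists u => //; apply/(minOver_leP _ _ yB); exists v => //; rewrite Phi_le.
Qed.

Lemma mem_groundStates (x : T) : exists s, s \in groundStates H.
Proof.
have [s _ sE] := minOver_mem H (finset.in_setT x).
by exists s; rewrite inE; apply/forallP => y; rewrite -sE minOver_le // in_setT.
Qed.

Lemma groundStates_pathLe s s' : s \in groundStates H -> s' \in groundStates H ->
  pathLe s s' PhiBar.
Proof.
move=> sS s'S; rewrite -Phi_le.
have /(le_maxOver (fun p => Phi p.1 p.2)) // :
  (s, s') \in finset.setX (groundStates H) (groundStates H).
by rewrite in_setX sS.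
Qed.

(** All ground states communicate at height [PhiBar], so one fixed ground state can stand for the
    whole set. *)
Lemma OmegaBarP s x : s \in groundStates H -> (x \in OmegaBar) = pathLe s x PhiBar.
Proof.
move=> sS; rewrite inE.
apply/(PhiSet_leP _ sS (set11 x))/idP => [[u [v [uS /set1P -> uv]]]|sx].
  exact: pathLe_trans (groundStates_pathLe sS uS) uv.
by exists s, x; rewrite sS set11.
Qed.

Lemma OmegaBar_pathLe x y : x \in OmegaBar -> y \in OmegaBar -> pathLe x y PhiBar.
Proof.
have [s sS] := mem_groundStates x; rewrite !(OmegaBarP _ sS) => /pathLe_sym.
exact: pathLe_trans.
Qed.

Lemma OmegaBar_H x : x \in OmegaBar -> H x <= PhiBar.
Proof. by have [s sS] := mem_groundStates x; rewrite (OmegaBarP _ sS) => /pathLe_r. Qed.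

Lemma OmegaBar_closed x y : x \in OmegaBar -> pathLe x y PhiBar -> y \in OmegaBar.
Proof.
have [s sS] := mem_groundStates x; rewrite !(OmegaBarP _ sS); exact: pathLe_trans.
Qed.

Lemma OmegaBar_edge x y : x \in OmegaBar -> e x y -> H y <= PhiBar -> y \in OmegaBar.
Proof. by move=> xO exy Hy; apply: OmegaBar_closed (pathLe_edge (OmegaBar_H xO) exy Hy). Qed.

(** The escape level: the absolute height whose excess over the bottom of [C] is [depth]. *)
Definition exitLevel (C : {set T}) : R := minOver (bdry C) H.

Lemma mem_bdry (C : {set T}) x y : x \in C -> y \notin C -> e x y -> y \in bdry C.
Proof.
by move=> xC yC exy; rewrite inE yC; apply/existsP; exists x; rewrite xC e_sym.
Qed.

Lemma bdryP (C : {set T}) y :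
  reflect (y \notin C /\ exists2 x, x \in C & e x y) (y \in bdry C).
Proof.
rewrite inE; apply: (iffP andP) => -[yC]; [move=> /existsP[x /andP[xC]]|case=> x xC exy].
  by rewrite e_sym => eyx; split=> //; exists x.
by split=> //; apply/existsP; exists x; rewrite xC e_sym.
Qed.

Lemma bdry_neq0 (C : {set T}) x y : x \in C -> y \notin C -> exists w, w \in bdry C.
Proof.
move=> xC yC; have [z /(pathLe_exit xC yC)[w wC _]] := ex_pathLe x y.
by exists w.
Qed.

Lemma mem_Fmin (A : {set T}) x : (x \in Fmin H A) = (x \in A) && (H x == minOver A H).
Proof.
rewrite inE; have [xA|//] := boolP (x \in A); rewrite /=.
apply/forall_inP/eqP => [xmin|-> y yA]; last exact: minOver_le.
have [y yA yE] := minOver_mem H xA.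
by apply/le_anti; rewrite {1}yE xmin // minOver_le.
Qed.

Lemma mem_bdryStar (C : {set T}) x :
  (x \in bdryStar e H C) = (x \in bdry C) && (H x == exitLevel C).
Proof. exact: mem_Fmin. Qed.

Lemma connectedSetP (C : {set T}) x y (P : T -> Prop) : connectedSet e C ->
  x \in C -> y \in C ->
  P x -> (forall z w, P z -> z \in C -> e z w -> w \in C -> P w) -> P y.
Proof.
move=> /forall_inP Cc xC yC Px step; have /forall_inP /(_ _ yC) := Cc _ xC.
move=> /(connect_invariant (P := fun z => P z /\ z \in C)) [] //.
by move=> z w [Pz zC] /andP[ezw wC]; split=> //; exact: step ezw wC.
Qed.

Lemma connectedSet_exit (C A : {set T}) x y : connectedSet e C ->
  x \in C -> y \in C -> x \in A -> y \notin A -> exists2 w, w \in C & w \in bdry A.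
Proof.
move=> Cc xC yC xA yA.
have : y \in A \/ exists2 w, w \in C & w \in bdry A.
  apply: (connectedSetP (P := fun y => y \in A \/ _) Cc xC yC); first by left.
  move=> z w [zA|//] zC ezw wC; last by right.
  by have [wA|wA] := boolP (w \in A); [left|right; exists w; rewrite // (mem_bdry zA)].
by case=> //; rewrite (negPf yA).
Qed.

(** * Cycles and their escape levels *)

Section Cycles.
Variable C : {set T}.
Hypothesis cycC : isCycle e H C.

Lemma cycle_connected : connectedSet e C. Proof. by case/and3P: cycC. Qed.

Lemma cycle_neq0 : exists x, x \in C.
Proof. by case/and3P: cycC => /set0Pn. Qed.

Lemma cycle_bdry_lt x y : x \in C -> y \in bdry C -> H x < H y.
Proof. by case/and3P: cycC => _ _ /forall_inP C3 /C3 /forall_inP; apply. Qed.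

(** The point [y] outside [C] makes the boundary nonempty, so that [exitLevel C] is a true
    minimum. *)
Lemma cycle_exit_lt x y : x \in C -> y \notin C -> H x < exitLevel C.
Proof.
move=> xC /(bdry_neq0 xC)[w wC].
by rewrite /exitLevel; have [z zC ->] := minOver_mem H wC; apply: cycle_bdry_lt.
Qed.

(** A path inside [C] climbs at most to the maximum of [H] on [C], which is strictly below the
    escape level. *)
Lemma cycle_pathLe x x' y : x \in C -> x' \in C -> y \notin C ->
  exists2 c, c < exitLevel C & pathLe x x' c.
Proof.
move=> xC x'C yC; have [z zC zE] := maxOver_mem H xC.
exists (H z); first exact: cycle_exit_lt yC.
apply: (connectedSetP (P := fun w => pathLe x w (H z)) cycle_connected xC x'C).
  by apply: pathLe_refl; rewrite -zE le_maxOver.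
move=> u v xu uC euv vC; apply: pathLe_trans xu _.
by apply: pathLe_edge => //; rewrite -zE le_maxOver.
Qed.

Lemma cycle_exitLevel_le x y c : x \in C -> y \notin C -> pathLe x y c ->
  exitLevel C <= c.
Proof.
move=> xC yC /(pathLe_exit xC yC)[w wC]; apply: le_trans; exact: minOver_le.
Qed.

End Cycles.

(** If neither contains the other, each has a point on the boundary of the other, and each of these
    two points would be strictly higher than the other. *)
Lemma cycles_nested (C D : {set T}) x : isCycle e H C -> isCycle e H D ->
  x \in C -> x \in D -> (C \subset D) \/ (D \subset C).
Proof.
move=> cC cD xC xD; have [|/subsetPn[y yC yD]] := boolP (C \subset D); first by left.
have [|/subsetPn[z zD zC]] := boolP (D \subset C); first by right.
have [w wC wD] := connectedSet_exit (cycle_connected cC) xC yC xD yD.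
have [v vD vC] := connectedSet_exit (cycle_connected cD) xD zD xC zC.
have := lt_trans (cycle_bdry_lt cC wC vC) (cycle_bdry_lt cD vD wD).
by rewrite ltxx.
Qed.

(* Two adjacent points of disjoint cycles would each have to be the higher one. *)
Lemma bdry_notin_cycle (C D : {set T}) x : isCycle e H C -> isCycle e H D ->
  [disjoint C & D] -> x \in bdry C -> x \notin D.
Proof.
move=> cC cD CD xbC; apply/negP => xD; have /bdryP[xC [y yC eyx]] := xbC.
have ybD : y \in bdry D.
  by apply: (mem_bdry xD); rewrite ?(disjointFr CD yC) // e_sym.
by have := lt_trans (cycle_bdry_lt cC yC xbC) (cycle_bdry_lt cD xD ybD); rewrite ltxx.
Qed.

(** * Plateaux: components of level sets and their stability *)

Definition plateau x : {set T} := [set y | connect (fun u v => e u v && (H v == H x)) x y].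

Lemma plateau_H x y : y \in plateau x -> H y = H x.
Proof.
by rewrite inE => /(connect_invariant (P := fun y => H y = H x)); apply=> // z w _ /andP[_ /eqP].
Qed.

Lemma plateau_pathLe x y : y \in plateau x -> pathLe x y (H x).
Proof.
move=> yP; suff [_ //] : H y = H x /\ pathLe x y (H x).
move: yP; rewrite inE.
apply: (connect_invariant (P := fun y => H y = H x /\ pathLe x y (H x))).
  by split; last exact: pathLe_refl.
move=> z w [Hz xz] /andP[ezw /eqP Hw]; split=> //; apply: pathLe_trans xz _.
by apply: pathLe_edge; rewrite // ?Hz ?Hw.
Qed.

Lemma plateau_connected x : connectedSet e (plateau x).
Proof.
have aux y z : y \in plateau x -> connect (fun u v => e u v && (H v == H x)) y z ->
    connect (fun u v => e u v && (v \in plateau x)) y z.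
  move=> yP; apply: (connect_invariant (P := fun z =>
    connect (fun u v => e u v && (v \in plateau x)) y z)) => [|u v yu /andP[euv Hv]].
    exact: connect0.
  apply: connect_trans (yu) (connect1 _); rewrite euv /=.
  have : u \in plateau x.
    apply: (connect_invariant (P := fun u => u \in plateau x)) yu => // a b _.
    by case/andP.
  by rewrite !inE => /connect_trans; apply; rewrite connect1 // euv.
apply/forall_inP => y yP; apply/forall_inP => z zP; apply: (aux) (yP) _.
have : connect (fun u v => e u v && (H v == H x)) x y by rewrite inE in yP.
move=> xy; apply: (@connect_trans _ _ x); last by rewrite inE in zP.
(* The walk from [x] is reversed; a reversed edge ends at the former tail, so its energy has to be
   remembered. *)
have [_ //] : H y = H x /\ connect (fun u v => e u v && (H v == H x)) y x.
apply: (connect_invariant (P := fun y => H y = H x /\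
  connect (fun u v => e u v && (H v == H x)) y x)) xy => [|u v [Hu ux] /andP[euv /eqP Hv]].
  by split; last exact: connect0.
by split=> //; apply: connect_trans (connect1 _) ux; rewrite e_sym euv Hu eqxx.
Qed.

Lemma plateau_self x : x \in plateau x. Proof. by rewrite inE connect0. Qed.

(** A neighbour at equal energy would belong to the component, so a weak inequality on the boundary
    is automatically strict. *)
Lemma plateau_stable x : (forall y, y \in bdry (plateau x) -> H x <= H y) ->
  stablePlateau e H (plateau x).
Proof.
move=> xmin; apply/and4P; split.
- by apply/set0Pn; exists x; exact: plateau_self.
- exact: plateau_connected.
- apply/forall_inP => y yP; apply/forall_inP => z zP.
  by rewrite (plateau_H yP) (plateau_H zP).
- apply/forall_inP => y yP; apply/forall_inP => z zP.
  rewrite (plateau_H yP) lt_neqAle xmin // andbT.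
  apply/negP => /eqP Hxz; have /bdryP[/negP zN [w wP ewz]] := zP; apply: zN.
  rewrite inE; rewrite inE in wP; apply: connect_trans wP (connect1 _).
  by rewrite ewz Hxz eqxx.
Qed.

Lemma plateau_OmegaBar x : x \in OmegaBar -> plateau x \subset OmegaBar.
Proof.
move=> xO; apply/fintype.subsetP => y; rewrite inE.
apply: (connect_invariant (P := fun y => y \in OmegaBar)) => // z w zO /andP[ezw /eqP Hw].
by apply: OmegaBar_edge ezw _ => //; rewrite Hw OmegaBar_H.
Qed.

Lemma stablePlateau_stay (P : {set T}) x y : stablePlateau e H P -> x \in P ->
  pathLe x y (H x) -> y \in P.
Proof.
case/and4P=> _ _ _ /forall_inP P3 xP xy; apply/negPn/negP => yP.
have [w wP] := pathLe_exit xP yP xy.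
by have /forall_inP /(_ w wP) := P3 _ xP; rewrite ltNge => /negP.
Qed.

Lemma stablePlateau_pathLe (P : {set T}) x y : stablePlateau e H P ->
  x \in P -> y \in P -> H x = H y /\ pathLe x y (H x).
Proof.
case/and4P=> _ Pc /forall_inP P3 _ xP yP.
have eqH z : z \in P -> H x = H z by move=> zP; have /forall_inP /(_ z zP) /eqP := P3 x xP.
split; first exact: eqH.
apply: (connectedSetP (P := fun w => pathLe x w (H x)) Pc xP yP); first exact: pathLe_refl.
move=> u v xu uP euv vP; apply: pathLe_trans xu _.
by apply: pathLe_edge => //; [rewrite (eqH u)|rewrite (eqH v)].
Qed.

End Landscape.

(** * The support graph of the chain *)

Section SupportGraph.
Variables (R : realType) (T : finType) (e : rel T) (H : T -> R).
Hypothesis e_sym : symmetric e.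
Hypothesis e_irr : irreflexive e.
Variables (Cs : {set {set T}}) (g : R).

Local Notation bdry := (bdry e).
Local Notation Delta := (Delta e H Cs).
Local Notation Cstar := (Cstar e H Cs g).
Local Notation rate := (rate e H Cs g).
Local Notation outRate := (outRate e H Cs g).
Local Notation jump := (jump e H Cs g).
Local Notation hitWithin := (hitWithin e H Cs g).
Local Notation hitProb := (hitProb e H Cs g).
Local Notation traceEdge := (traceEdge e H Cs g).
Local Notation traceRate := (traceRate e H Cs g).
Local Notation reach := (reach e H Cs g).
Local Notation stars := (PstarStates e H Cs g).
Local Notation St := (T + {set T})%type.

(** Positivity of trace rates depends only on which rates are positive, so the chain is replaced by
    this graph. *)
Definition arrow (s t : St) : bool := 0 < rate s t.

Lemma rate_ge0 s t : 0 <= rate s t.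
Proof.
by case: s t => [a|C] [b|D] //=; case: ifP => // _; rewrite ?mulr_ge0 ?invr_ge0 ?ler0n.
Qed.

Lemma arrow_ll a b :
  arrow (inl a) (inl b) = [&& a \in Delta, b \in Delta, e a b & H b <= H a].
Proof. by rewrite /arrow /=; case: ifP; rewrite ?ltr01 ?ltxx. Qed.

Lemma arrow_lr a C : arrow (inl a) (inr C) = [&& a \in Delta, C \in Cs & a \in bdry C].
Proof.
rewrite /arrow /=; case: ifP; rewrite ?ltxx // => /and3P[_ _ /bdryP-/(_ e_sym)[_ [x xC exa]]].
by rewrite ltr0n; apply/card_gt0P; exists x; rewrite inE xC e_sym.
Qed.

Lemma arrow_rl C b : arrow (inr C) (inl b) =
  [&& C \in Cs, b \in Delta, depth e H C <= g & b \in bdryStar e H C].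
Proof.
rewrite /arrow /=; case: ifP; rewrite ?ltxx // => /and4P[_ _ _].
rewrite mem_bdryStar => /andP[/bdryP-/(_ e_sym)[_ [x xC exa]] _].
rewrite mulr_gt0 ?invr_gt0 ?ltr0n //; last first.
  by apply/card_gt0P; exists x; rewrite inE xC e_sym.
have [y yC yE] := minOver_mem H xC.
by apply/card_gt0P; exists y; rewrite mem_Fmin yC yE eqxx.
Qed.

Lemma arrow_rr C D : arrow (inr C) (inr D) = false.
Proof. by rewrite /arrow ltxx. Qed.

Lemma arrow_irr s : arrow s s = false.
Proof. by case: s => [a|C]; rewrite ?arrow_ll ?arrow_rr // e_irr !andbF. Qed.

Lemma outRate_ge0 s : 0 <= outRate s.
Proof. by apply: sumr_ge0 => t _; exact: rate_ge0. Qed.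

Lemma jump_ge0 s t : 0 <= jump s t.
Proof.
rewrite /Defs.jump; case: ifP => // _; case: ifP => // _.
by rewrite divr_ge0 ?rate_ge0 ?outRate_ge0.
Qed.

Lemma sum_jump s : \sum_t jump s t = 1.
Proof.
rewrite /Defs.jump; case: (eqVneq (outRate s) 0) => [_|out0].
  rewrite (bigD1 s) //= eqxx big1 ?addr0 // => t ts.
  by rewrite eq_sym (negPf ts).
rewrite (bigD1 s) //= eqxx add0r.
under eq_bigr => t ts do rewrite (negPf ts).
by rewrite -mulr_suml divff.
Qed.

(** Irreflexivity of [e] excludes loops, which [outRate] and [jump] leave out. *)
Lemma arrow_jump s t : arrow s t -> 0 < jump s t.
Proof.
move=> st; have ts : t != s by apply: contraTneq st => ->; rewrite arrow_irr.
have out0 : 0 < outRate s.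
  rewrite /Defs.outRate (bigD1 t) //= ltr_pwDl //.
  by apply: sumr_ge0 => u _; exact: rate_ge0.
by rewrite /Defs.jump gt_eqF // (negPf ts) divr_gt0.
Qed.

(** The first alternative accounts for states with zero exit rate, where the jump chain stays
    put. *)
Lemma jump_arrow s t : 0 < jump s t -> s = t \/ arrow s t.
Proof.
rewrite /Defs.jump; case: ifP => [_|out0].
  by case: eqVneq => [|_]; [left|rewrite ltxx].
case: ifP => _; first by rewrite ltxx.
move=> st; right; rewrite /arrow lt0r rate_ge0 andbT.
by apply: contraTneq st => ->; rewrite mul0r ltxx.
Qed.

(** * Hitting probabilities and reachability *)

Section Hitting.
Variables (A : {set St}) (a : St).

Lemma hitWithin_bounds n s : 0 <= hitWithin A a n s <= 1.
Proof.
elim: n s => [|n IH] s /=; case: ifP => // _; rewrite ?lexx ?ler01 //;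
  try by case: eqP => _; rewrite ?lexx ?ler01.
apply/andP; split.
  by apply: sumr_ge0 => t _; rewrite mulr_ge0 ?jump_ge0 //; case/andP: (IH t).
rewrite -(sum_jump s); apply: ler_sum => t _.
by rewrite -[leRHS]mulr1 ler_wpM2l ?jump_ge0 //; case/andP: (IH t).
Qed.

Lemma hitWithin_homo s : {homo hitWithin A a ^~ s : n m / (n <= m)%N >-> n <= m}.
Proof.
apply: homo_leq => [//|x y z|n]; first exact: le_trans.
elim: n s => [|n IH] s /=; case: ifP => // _.
  by apply: sumr_ge0 => t _; rewrite mulr_ge0 ?jump_ge0 //; case/andP: (hitWithin_bounds 0 t).
by apply: ler_sum => t _; rewrite ler_wpM2l ?jump_ge0.
Qed.

(** The sequence in [n] is nondecreasing and bounded by 1, so [limn] is a genuine limit dominating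
    every term. *)
Lemma hitWithin_le n s : hitWithin A a n s <= hitProb A a s.
Proof.
apply: nondecreasing_cvgn_le; first exact: hitWithin_homo.
apply: nondecreasing_is_cvgn; first exact: hitWithin_homo.
by exists 1 => _ [m _ <-]; case/andP: (hitWithin_bounds m s).
Qed.

Lemma hitProb_ge0 s : 0 <= hitProb A a s.
Proof. by apply: le_trans (hitWithin_le 0 s); case/andP: (hitWithin_bounds 0 s). Qed.

Lemma hitProb_connect s : 0 < hitProb A a s -> connect arrow s a.
Proof.
move=> hs; have [n hn] : exists n, 0 < hitWithin A a n s.
  apply: contrapT => hN; move: hs; rewrite /Defs.hitProb.
  (* If no term were positive, the sequence and hence its limit would vanish. *)
  rewrite (_ : (fun n => _) = fun=> 0) ?lim_cst ?ltxx //.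
  apply/funext => n; apply: contrapT => /eqP hn; apply: hN; exists n.
  by rewrite lt0r hn; case/andP: (hitWithin_bounds n s).
elim: n s {hs} hn => [|n IH] s /=; case: ifP => _; rewrite ?ltxx //;
  try by case: eqVneq => [-> _|_]; rewrite ?ltxx.
rewrite lt0r => /andP[/eqP hn _].
have [|t /= ht] := psumr_neq0P _ hn.
  by move=> t _; rewrite mulr_ge0 ?jump_ge0 //; case/andP: (hitWithin_bounds n t).
have [h0 _] := andP (hitWithin_bounds n t).
have ht' : 0 < hitWithin A a n t.
  by rewrite lt0r h0 andbT; apply: contraTneq ht => ->; rewrite mulr0 ltxx.
have : 0 < jump s t.
  by rewrite lt0r jump_ge0 andbT; apply: contraTneq ht => ->; rewrite mul0r ltxx.
move=> /jump_arrow[->|st]; first exact: IH.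
exact: connect_trans (connect1 st) (IH _ ht').
Qed.

(** Along the walk, the product of the finitely many positive jump probabilities is a lower bound;
    no vertex before the last is in [A], so the recursion does not stop early. *)
Lemma connect_hitProb s : a \in A ->
  connect (fun u v => (u \notin A) && arrow u v) s a -> 0 < hitProb A a s.
Proof.
move=> aA /connectP[p sp ap].
have [n hn] : exists n, 0 < hitWithin A a n s; last exact: lt_le_trans (hitWithin_le n s).
elim: p s sp ap => [|t p IH] s /= => [_ <-|/andP[/andP[sA st] tp] ap].
  by exists 0%N; rewrite /= aA eqxx ltr01.
have [n hn] := IH _ tp ap; exists n.+1; rewrite /= (negPf sA).
rewrite (bigD1 t) //= ltr_pwDl ?mulr_gt0 ?arrow_jump //.
apply: sumr_ge0 => u _; rewrite mulr_ge0 ?jump_ge0 //.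
by case/andP: (hitWithin_bounds n u).
Qed.

End Hitting.

Lemma mem_stars C : ((inr C : St) \in stars) = (C \in Cstar).
Proof. by apply/imsetP/idP => [[D DC [->]]//|CC]; exists C. Qed.

Lemma inl_stars x : ((inl x : St) \in stars) = false.
Proof. by apply/negP => /imsetP[]. Qed.

(** A positive sum has a positive summand, which provides a first arrow into [Delta] and then a walk
    to the hit cycle. *)
Lemma traceEdge_connect C D : traceEdge C D -> connect arrow (inr C) (inr D).
Proof.
move=> /and4P[_ _ _]; rewrite lt0r => /andP[/eqP tr _].
have [|x /andP[_ hx]] := psumr_neq0P _ tr.
  by move=> x _; rewrite mulr_ge0 ?rate_ge0 ?hitProb_ge0.
apply: (@connect_trans _ _ (inl x : St)).
  apply: connect1; rewrite /arrow lt0r rate_ge0 andbT.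
  by apply: contraTneq hx => ->; rewrite mul0r ltxx.
apply: (@hitProb_connect stars); rewrite lt0r hitProb_ge0 andbT.
by apply: contraTneq hx => ->; rewrite mulr0 ltxx.
Qed.

Lemma reach_connect C D : reach C D -> connect arrow (inr C) (inr D).
Proof.
apply: (connect_invariant (P := fun D => connect arrow (inr C) (inr D))) => [|E F CE EF].
  exact: connect0.
exact: connect_trans CE (traceEdge_connect EF).
Qed.

(* Split a walk of the chain at its successive visits to the star cycles. *)
Lemma connect_reach C D : C \in Cstar -> D \in Cstar ->
  connect arrow (inr C) (inr D) -> reach C D.
Proof.
move=> CC DD /connectP[p Cp Dp].
pose pre := connect (fun u v => (u \notin stars) && arrow u v).
(* Generalised to walks from any state: [E] is a star cycle reached without an earlier visit to the
   star cycles, and is the starting one if that is a star. *)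
suff : forall s, path arrow s p -> inr D = last s p ->
    exists2 E, (E \in Cstar) && (if s is inr C' then if C' \in Cstar then E == C'
      else pre s (inr E) else pre s (inr E)) & reach E D.
  by move=> /(_ _ Cp Dp)[E]; rewrite CC => /andP[_ /eqP ->].
elim: p {Cp Dp} => [|t p IH] s /=.
  by move=> _ <-; exists D; [rewrite DD eqxx|exact: connect0].
move=> /andP[st tp] Dp; have [E /andP[EE tE] ED] := IH _ tp Dp.
have tE' : pre t (inr E).
  case: t {IH tp Dp st} tE => // F; case: ifP => // _ /eqP ->; exact: connect0.
case: s st => [x|C'] st.
  exists E => //; rewrite EE; apply: connect_trans tE'; apply: connect1.
  by rewrite inl_stars.
have [C'C|C'C] := boolP (C' \in Cstar); last first.
  exists E => //; rewrite EE; apply: connect_trans tE'; apply: connect1.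
  by rewrite mem_stars C'C.
exists C'; rewrite ?C'C ?eqxx //.
have [<- //|EC'] := eqVneq E C'.
apply: connect_trans ED; apply: connect1; rewrite /Defs.traceEdge C'C EE eq_sym EC' /=.
case: t st tE' {IH tp Dp tE} => [x st tE|F]; last by rewrite arrow_rr.
(* The arrow out of the star cycle [C'] ends in [Delta]; the summand of [traceRate] at this point is
   positive. *)
have xD : x \in Delta by move: st; rewrite arrow_rl => /and4P[].
rewrite /Defs.traceRate (bigD1 x xD) ltr_pwDl //.
  by rewrite mulr_gt0 //; apply: connect_hitProb tE; rewrite mem_stars.
by apply: sumr_ge0 => y _; apply: mulr_ge0; [exact: rate_ge0|exact: hitProb_ge0].
Qed.

End SupportGraph.

(** * Flow of the chain *)

(** What the flow argument uses of a pair in construction (C), independently of the level.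
    [covering_two] leaves part of [OmegaBar] outside each cycle, so boundaries are nonempty;
    [covering_sharp] lets a sharp cycle see a star cycle at its own escape level. *)
Record covering (R : realType) (T : finType) (e : rel T) (H : T -> R)
    (Cs : {set {set T}}) (g : R) : Prop := Covering {
  covering_cycle : forall C, C \in Cs -> isCycle e H C;
  covering_sub : forall C, C \in Cs -> C \subset OmegaBar e H;
  covering_disjoint : forall C D, C \in Cs -> D \in Cs -> C != D -> [disjoint C & D];
  covering_two : forall C, C \in Cs -> exists2 D, D \in Cs & D != C;
  covering_plateau : forall x, x \in OmegaBar e H -> stablePlateau e H (plateau e H x) ->
    exists2 C, C \in Cs & x \in C;
  covering_sharp : forall C, C \in Csharp e H Cs g ->
    exists x y (D : {set T}), [/\ x \in C, y \in D, D \in Cstar e H Cs g & pathLe e H x y (exitLevel e H C)]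
}.

Section Flow.
Variables (R : realType) (T : finType) (e : rel T) (H : T -> R).
Hypothesis e_sym : symmetric e.
Hypothesis e_conn : forall x y : T, connect e x y.
Variables (Cs : {set {set T}}) (g : R).
Hypothesis cov : covering e H Cs g.

Local Notation pathLe := (pathLe e H).
Local Notation OmegaBar := (OmegaBar e H).
Local Notation PhiBar := (PhiBar e H).
Local Notation exitLevel := (exitLevel e H).
Local Notation depth := (depth e H).
Local Notation bdry := (bdry e).
Local Notation Delta := (Delta e H Cs).
Local Notation Cstar := (Cstar e H Cs g).
Local Notation Csharp := (Csharp e H Cs g).
Local Notation arrow := (arrow e H Cs g).
Local Notation St := (T + {set T})%type.
Implicit Types (s t u : St) (x y z : T) (C D : {set T}).

Definition isState s : bool :=
  match s with inl x => x \in Delta | inr C => C \in Cs end.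

Definition inState x s : bool :=
  match s with inl y => x == y | inr C => x \in C end.

Definition level s : R :=
  match s with inl x => H x | inr C => exitLevel C end.

(** Disjointness of the cycles makes the picked one unique; the default [inl x] is a state exactly
    when [x] is in [Delta]. *)
Definition stateOf x : St :=
  if [pick C in Cs | x \in C] is Some C then inr C else inl x.

Lemma mem_Delta x : (x \in Delta) = (x \in OmegaBar) && [forall C in Cs, x \notin C].
Proof.
rewrite in_setD andbC; congr (_ && _); apply/negP/forall_inP => [xN C CC|xN /bigcupP[C /xN/negP//]].
by apply/negP => xC; apply: xN; apply/bigcupP; exists C.
Qed.

Lemma stateOf_in C x : C \in Cs -> x \in C -> stateOf x = inr C.
Proof.
move=> CC xC; rewrite /stateOf; case: pickP => [D /andP[DD xD]|/(_ C)]; last by rewrite CC xC.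
congr inr; apply/eqP; apply: contraTT xD => DC.
by rewrite (disjointFl (covering_disjoint cov DD CC DC)).
Qed.

Lemma stateOf_Delta x : x \in Delta -> stateOf x = inl x.
Proof.
rewrite mem_Delta => /andP[_ /forall_inP xN]; rewrite /stateOf; case: pickP => // C /andP[CC].
by rewrite (negPf (xN _ CC)).
Qed.

Lemma DeltaPn x : x \in OmegaBar -> x \in Delta \/ exists2 C, C \in Cs & x \in C.
Proof.
move=> xO; rewrite mem_Delta xO /=.
have [|/forall_inPn[C CC /negbNE xC]] := boolP [forall C in Cs, x \notin C]; first by left.
by right; exists C.
Qed.

Lemma cycle_complement C : C \in Cs -> exists2 y, y \in OmegaBar & y \notin C.
Proof.
move=> CC; have [D DD DC] := covering_two cov CC.
have [y yD] := cycle_neq0 (covering_cycle cov DD); exists y.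
  exact: (fintype.subsetP (covering_sub cov DD)).
by rewrite (disjointFr (covering_disjoint cov DD CC DC)).
Qed.

(** Some point of [OmegaBar] lies outside [C], and all points of [OmegaBar] communicate at height
    [PhiBar]. *)
Lemma exitLevel_PhiBar C : C \in Cs -> exitLevel C <= PhiBar.
Proof.
move=> CC; have [y yO yC] := cycle_complement CC.
have [x xC] := cycle_neq0 (covering_cycle cov CC).
have xO := fintype.subsetP (covering_sub cov CC) _ xC.
exact: cycle_exitLevel_le xC yC (OmegaBar_pathLe e_sym e_conn xO yO).
Qed.

Lemma bdry_Delta C y : C \in Cs -> y \in bdry C -> H y <= PhiBar -> y \in Delta.
Proof.
move=> CC yC Hy; have /(bdryP e_sym)[yN [x xC exy]] := yC; rewrite mem_Delta.
have xO := fintype.subsetP (covering_sub cov CC) _ xC.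
rewrite (OmegaBar_edge e_conn xO exy Hy) /=; apply/forall_inP => D DD.
have [<- //|CD] := eqVneq C D.
apply: bdry_notin_cycle (covering_cycle cov CC) (covering_cycle cov DD) _ yC => //.
exact: (covering_disjoint cov).
Qed.

Lemma cycle_pathLe_exit C x y : C \in Cs -> x \in C -> y \in C -> pathLe x y (exitLevel C).
Proof.
move=> CC xC yC; have [z _ zC] := cycle_complement CC.
have [c cC] := cycle_pathLe e_sym e_conn (covering_cycle cov CC) xC yC zC.
exact/pathLe_mono/ltW.
Qed.

Lemma mem_cycle_lt C x : C \in Cs -> x \in C -> H x < exitLevel C.
Proof.
move=> CC xC; have [z _ zC] := cycle_complement CC.
exact: cycle_exit_lt (covering_cycle cov CC) _ _ xC zC.
Qed.

(** A cycle is entered from one of its boundary points, at least as high as its escape level, and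
    left through a lowest one, exactly at that level. *)
Lemma arrow_level s t : arrow s t -> level t <= level s.
Proof.
case: s t => [x|C] [y|D]; rewrite ?(arrow_ll, arrow_lr, arrow_rl, arrow_rr) //.
- by case/and4P.
- by case/and3P=> _ _ /= xD; apply: minOver_le.
- by case/and4P=> _ _ _; rewrite mem_bdryStar => /andP[_ /eqP Hy] /=; rewrite Hy.
Qed.

Lemma arrow_isState s t : arrow s t -> isState t.
Proof.
by case: s t => [x|C] [y|D]; rewrite ?(arrow_ll, arrow_lr, arrow_rl, arrow_rr) //;
  [case/and4P|case/and3P|case/and4P].
Qed.

Lemma connect_level s t : connect arrow s t -> level t <= level s.
Proof.
apply: (connect_invariant (P := fun t => level t <= level s)) => // u v us /arrow_level.
by move/le_trans; apply.
Qed.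

Lemma connect_isState s t : isState s -> connect arrow s t -> isState t.
Proof.
move=> sS; apply: (connect_invariant (P := isState)) => // u v _; exact: arrow_isState.
Qed.

(** Each visited cycle is crossed by a path inside it, below its own escape level, which is at most
    the initial level by [arrow_level]. *)
Lemma connect_pathLe s t x y : isState s -> connect arrow s t ->
  inState x s -> inState y t -> pathLe x y (level s).
Proof.
move=> sS st xs.
suff [_ [_ ]] : isState t /\ level t <= level s /\ forall y, inState y t -> pathLe x y (level s) by apply.
apply: (connect_invariant (P := fun t => isState t /\ level t <= level s /\
  forall y, inState y t -> pathLe x y (level s))) st => [|{}t u [tS [ts xt]] tu].
  split=> //; split=> // {}y; case: s sS xs => [a|C] /= sS; last exact: cycle_pathLe_exit.
  by move=> /eqP -> /eqP ->; exact: pathLe_refl.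
have us := le_trans (arrow_level tu) ts.
split; first exact: arrow_isState tu.
split=> // {}y yu; case: t u tu tS ts xt us yu => [a|C] [b|D] /=;
  rewrite ?(arrow_ll, arrow_lr, arrow_rl, arrow_rr) // => tu tS ts xt us.
- move=> /eqP ->; apply: pathLe_trans (xt a (eqxx a)) _.
  by case/and4P: tu => *; apply: pathLe_edge.
- case/and3P: tu => _ DD /(bdryP e_sym)[aD [z zD eza]] yD.
  apply: pathLe_trans (xt a (eqxx a)) _; apply: (@pathLe_trans _ _ _ _ z).
    apply: pathLe_edge => //; first by rewrite e_sym.
    exact: le_trans (ltW (mem_cycle_lt DD zD)) us.
  exact: pathLe_mono us (cycle_pathLe_exit DD zD yD).
- case/and4P: tu => CC _ _; rewrite mem_bdryStar => /andP[/(bdryP e_sym)[bC [z zC ezb]] _] /eqP ->.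
  apply: pathLe_trans (xt z zC) _; apply: pathLe_edge => //.
  exact: le_trans (ltW (mem_cycle_lt CC zC)) ts.
Qed.

Lemma connect_shallow C D : C \in Cs -> connect arrow (inr C) (inr D) -> D != C -> depth C <= g.
Proof.
move=> CC /connectP[[|[x|E] p]] /=.
- by move=> _ [->]; rewrite eqxx.
- by rewrite arrow_rl // => /andP[/and4P[]].
- by rewrite arrow_rr.
Qed.

(* An uphill step of the path starts below the escape level of [C], where the second alternative
   holds; a step that leaves a cycle at that level passes through its [bdryStar]. *)
Lemma follow_path C x y : C \in Cs -> x \in C -> pathLe x y (exitLevel C) ->
  [\/ connect arrow (inr C) (stateOf y),
      (exists2 t, connect arrow (inr C) t & level t < exitLevel C) |
      (exists2 D, D \in Cstar & connect arrow (inr C) (inr D) /\ g < depth D)].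
Proof.
move=> CC xC xy; have cPB := exitLevel_PhiBar CC.
have [_ //] : y \in OmegaBar /\ [\/ connect arrow (inr C) (stateOf y),
      (exists2 t, connect arrow (inr C) t & level t < exitLevel C) |
      (exists2 D, D \in Cstar & connect arrow (inr C) (inr D) /\ g < depth D)].
apply: (pathLe_ind (P := fun y => y \in OmegaBar /\ [\/ connect arrow (inr C) (stateOf y), _ | _])) xy.
  split; first exact: (fintype.subsetP (covering_sub cov CC)).
  by apply: Or31; rewrite (stateOf_in CC xC) connect0.
move=> z w [zO IH] Hz ezw Hw.
have wO := OmegaBar_edge e_conn zO ezw (le_trans Hw cPB); split=> //.
case: IH => [Cz|lo|deep]; [|exact: Or32|exact: Or33].
have [lo|hi] := ltP (level (stateOf z)) (exitLevel C); first by apply: Or32; exists (stateOf z).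
have [zD|[D DD zD]] := DeltaPn zO.
  apply: Or31; apply: connect_trans Cz (connect1 _).
  rewrite (stateOf_Delta zD) /= in hi *.
  have [wD|[D DD wD]] := DeltaPn wO.
    by rewrite (stateOf_Delta wD) arrow_ll zD wD ezw (le_trans Hw hi).
  rewrite (stateOf_in DD wD) arrow_lr // zD DD (mem_bdry e_sym wD) //.
    by move: zD; rewrite mem_Delta => /andP[_ /forall_inP]; apply.
  by rewrite e_sym.
rewrite (stateOf_in DD zD) /= in Cz hi *.
have [wD|wD] := boolP (w \in D); first by apply: Or31; rewrite (stateOf_in DD wD).
have wbD := mem_bdry e_sym zD wD ezw.
have wDelta : w \in Delta by apply: bdry_Delta DD wbD _; exact: le_trans cPB.
have [deep|shallow] := ltP g (depth D).
  by apply: Or33; exists D; rewrite // inE DD ltW.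
apply: Or31; apply: connect_trans Cz (connect1 _); rewrite (stateOf_Delta wDelta).
rewrite arrow_rl // DD wDelta shallow mem_bdryStar wbD /= eq_le (minOver_le _ wbD) andbT.
exact: le_trans hi.
Qed.

(** If no cycle is reached, a lowest point of [Delta] reachable from [x] has a stable plateau, and
    so lies in a cycle of the covering after all. *)
Lemma downhill x : x \in Delta -> exists2 C, C \in Cs & connect arrow (inl x) (inr C).
Proof.
move=> xD; apply: contrapT => noC.
have xX : x \in [set z in Delta | connect arrow (inl x) (inl z)] by rewrite inE xD connect0.
have [z] := minOver_mem H xX; rewrite inE => /andP[zD xz] zmin.
(* A non-climbing step from a reached point stays in [Delta], for otherwise it would enter a
   cycle. *)
have lez w : w \in OmegaBar -> forall v, v \in Delta -> connect arrow (inl x) (inl v) ->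
    e v w -> H w <= H v -> w \in Delta /\ connect arrow (inl x) (inl w).
  move=> wO v vD xv evw Hw; have [wD|[C CC wC]] := DeltaPn wO.
    by split=> //; apply: connect_trans xv (connect1 _); rewrite arrow_ll vD wD evw.
  case: noC; exists C => //; apply: connect_trans xv (connect1 _).
  rewrite arrow_lr // vD CC (mem_bdry e_sym wC) //; last by rewrite e_sym.
  by move: vD; rewrite mem_Delta => /andP[_ /forall_inP]; apply.
have inO w : w \in Delta -> w \in OmegaBar by rewrite mem_Delta => /andP[].
have zO := inO z zD.
have plat w : w \in plateau e H z -> w \in Delta /\ connect arrow (inl x) (inl w).
  move=> wP; have wO := fintype.subsetP (plateau_OmegaBar e_conn zO) _ wP.
  suff [_ //] : H w = H z /\ (w \in Delta /\ connect arrow (inl x) (inl w)).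
  move: wP; rewrite inE.
  apply: (connect_invariant (P := fun w => H w = H z /\
    (w \in Delta /\ connect arrow (inl x) (inl w)))) => //.
  move=> u v [Hu [uD xu]] /andP[euv /eqP Hv]; split=> //; apply: (lez v _ u uD xu euv); last by rewrite Hu Hv.
  by apply: (OmegaBar_edge e_conn (inO u uD) euv); rewrite Hv -Hu OmegaBar_H // inO.
have stab : stablePlateau e H (plateau e H z).
  apply: plateau_stable => // y /(bdryP e_sym)[yP [w wP ewy]].
  rewrite leNgt; apply/negP => Hy.
  have [wD xw] := plat _ wP; have Hw := plateau_H wP.
  have Hyw : H y <= H w by rewrite Hw ltW.
  have yO : y \in OmegaBar.
    by apply: (OmegaBar_edge e_conn (inO w wD) ewy); apply: le_trans Hyw _; rewrite OmegaBar_H // inO.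
  have [yD xy] := lez _ yO _ wD xw ewy Hyw.
  have : H z <= H y by rewrite -zmin minOver_le // inE yD.
  by rewrite leNgt Hy.
have [C CC zC] := covering_plateau cov zO stab.
by move: zD; rewrite mem_Delta => /andP[_ /forall_inP /(_ _ CC)]; rewrite zC.
Qed.

(* Among the states reachable from [s], one of least level is a cycle; if it is sharp, the
   path of [covering_sharp] can be followed up to a star cycle. *)
Lemma flow s : isState s -> exists2 D, D \in Cstar & connect arrow s (inr D).
Proof.
move=> sS; apply: contrapT => noD.
have sX : s \in [set t | connect arrow s t] by rewrite inE connect0.
have [t] := minOver_mem level sX; rewrite inE => st tmin.
have ge_t u : connect arrow s u -> level t <= level u.
  by move=> su; rewrite -tmin minOver_le // inE.
have [C CC tC] : exists2 C, C \in Cs & connect arrow t (inr C).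
  have := connect_isState sS st; case: (t) => [x|C] /= tS; first exact: downhill.
  by exists C => //; exact: connect0.
have sC := connect_trans st tC.
have CN : C \notin Cstar by apply/negP => CN; apply: noD; exists C.
have Csh : C \in Csharp by move: CN; rewrite !inE CC /= -ltNge.
have [x [y [D [xC yD DD xy]]]] := covering_sharp cov Csh.
have DCs : D \in Cs by move: DD; rewrite inE => /andP[].
case: (follow_path CC xC xy) => [CD|[u Cu uC]|[E EE [CE _]]].
- apply: noD; exists D => //; apply: connect_trans sC _.
  by rewrite (stateOf_in DCs yD) in CD.
- have : level u < level t.
    by apply: lt_le_trans uC _; rewrite -[exitLevel C]/(level (inr C)) (connect_level tC).
  by rewrite ltNge ge_t // (connect_trans sC).
- by apply: noD; exists E => //; apply: connect_trans sC _.
Qed.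

End Flow.

(** * Closed classes of the trace chain *)

Section Classes.
Variables (R : realType) (T : finType) (e : rel T) (H : T -> R).
Hypothesis e_sym : symmetric e.
Hypothesis e_irr : irreflexive e.
Hypothesis e_conn : forall x y : T, connect e x y.
Variables (Cs : {set {set T}}) (g : R).
Hypothesis cov : covering e H Cs g.

Local Notation pathLe := (pathLe e H).
Local Notation exitLevel := (exitLevel e H).
Local Notation depth := (depth e H).
Local Notation Cstar := (Cstar e H Cs g).
Local Notation arrow := (arrow e H Cs g).
Local Notation reach := (reach e H Cs g).
Local Notation classes := (closedClasses e H Cs g).
Implicit Types (x y z : T) (C D : {set T}) (K : {set {set T}}).

Lemma star_Cs C : C \in Cstar -> C \in Cs.
Proof. by rewrite inE => /andP[]. Qed.

Lemma star_depth C : C \in Cstar -> g <= depth C.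
Proof. by rewrite inE => /andP[]. Qed.

Lemma exitLevelE C : exitLevel C = minOver C H + depth C.
Proof. by rewrite /Defs.depth addrC subrK. Qed.

Lemma reach_star C D : C \in Cstar -> reach C D -> D \in Cstar.
Proof.
move=> CC; apply: (connect_invariant (P := fun D => D \in Cstar)) => // E F _.
by case/and4P.
Qed.

Lemma classP K C : K \in classes -> C \in K ->
  [/\ C \in Cstar, K = [set D | reach C D] & forall D, D \in K -> reach D C].
Proof.
rewrite inE => /existsP[B /andP[BB /andP[/eqP -> /forall_inP BK]]] CK.
have CB := BK _ CK; have BC : reach B C by rewrite inE in CK.
split; first exact: reach_star BC.
  apply/setP => D; rewrite !inE; apply/idP/idP; exact: connect_trans.
move=> D /BK DB; exact: connect_trans DB BC.
Qed.

Lemma class_neq0 K : K \in classes -> exists C, C \in K.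
Proof.
rewrite inE => /existsP[B /andP[BB /andP[/eqP -> _]]].
by exists B; rewrite inE; exact: connect0.
Qed.

Lemma class_Cs K C : K \in classes -> C \in K -> C \in Cs.
Proof. by move=> KK /(classP KK)[/star_Cs]. Qed.

Lemma class_eq K K' C : K \in classes -> K' \in classes -> C \in K -> C \in K' -> K = K'.
Proof. by move=> KK KK' /(classP KK)[_ -> _] /(classP KK')[_ -> _]. Qed.

Lemma class_reach K C D : K \in classes -> C \in K -> D \in K -> reach C D.
Proof. by move=> KK /(classP KK)[_ -> _]; rewrite inE. Qed.

Lemma class_connect K C D : K \in classes -> C \in K -> D \in Cstar ->
  connect arrow (inr C) (inr D) -> D \in K.
Proof.
move=> KK CK DD CD; have [CC -> _] := classP KK CK.
by rewrite inE; apply: connect_reach.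
Qed.

(* A star cycle reaching as few cycles as possible generates a closed class. *)
Lemma reach_class C : C \in Cstar -> exists2 K, K \in classes & exists2 D, D \in K & reach C D.
Proof.
move=> CC; pose r D := [set E | reach D E].
have := @arg_minnP _ C (reach C) (fun D => #|r D|) (connect0 _ _).
case=> D CD Dmin; have DD := reach_star CC CD.
exists (r D); last by exists D => //; rewrite inE; exact: connect0.
rewrite inE; apply/existsP; exists D; rewrite DD eqxx /=.
apply/forall_inP => E; rewrite inE => DE.
have rED : r E \subset r D by apply/fintype.subsetP => F; rewrite !inE; exact: connect_trans.
have /eqP rE : r E == r D by rewrite eqEcard rED Dmin //; exact: connect_trans DE.
have : D \in r E by rewrite rE inE; exact: connect0.
by rewrite inE.
Qed.

Lemma flow_class s : isState e H Cs s ->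
  exists2 K, K \in classes & exists2 D, D \in K & connect arrow s (inr D).
Proof.
move=> /(flow e_sym e_conn cov)[C CC sC]; have [K KK [D DK CD]] := reach_class CC.
by exists K => //; exists D => //; apply: connect_trans sC (reach_connect CD).
Qed.

(** The level cannot increase along the chain, and the two cycles reach each other. *)
Lemma class_exitLevel K C D : K \in classes -> C \in K -> D \in K -> exitLevel C = exitLevel D.
Proof.
move=> KK CK DK; apply/le_anti/andP; split.
  exact: (connect_level e_sym (reach_connect (class_reach KK DK CK))).
exact: (connect_level e_sym (reach_connect (class_reach KK CK DK))).
Qed.

(** The chain must leave [C] to reach [D], which requires depth at most [g]; star cycles have depth
    at least [g]. *)
Lemma class_depth K C D : K \in classes -> C \in K -> D \in K -> C != D -> depth C = g.
Proof.
move=> KK CK DK CD; have [CC _ _] := classP KK CK.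
apply/le_anti; rewrite star_depth // andbT.
apply: (connect_shallow e_sym (star_Cs CC) (reach_connect (class_reach KK CK DK))).
by rewrite eq_sym.
Qed.

(** Equal escape levels and equal depths force equal bottoms, so the union of the bottoms of a class
    has constant energy. *)
Lemma class_minOver K C D : K \in classes -> C \in K -> D \in K -> minOver C H = minOver D H.
Proof.
move=> KK CK DK; have [-> //|CD] := eqVneq C D.
have := class_exitLevel KK CK DK; rewrite !exitLevelE (class_depth KK CK DK CD).
by rewrite (class_depth KK DK CK) 1?eq_sym // => /addIr.
Qed.

Lemma class_pathLe K C D x y : K \in classes -> C \in K -> D \in K -> x \in C -> y \in D ->
  pathLe x y (exitLevel C).
Proof.
move=> KK CK DK xC yD; have CC := class_Cs KK CK.
exact: (connect_pathLe e_sym e_conn cov (s := inr C) CC (reach_connect (class_reach KK CK DK))).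
Qed.

Lemma transient_depth C : C \in Ctr e H Cs g -> depth C <= g.
Proof.
rewrite inE => /andP[CC /forall_inP CN]; have [K KK [D DK CD]] := reach_class CC.
apply: (connect_shallow e_sym (star_Cs CC) (reach_connect CD)).
by apply: contraTneq DK => ->; exact: CN.
Qed.

Lemma class_cycle_notin K K' C D y : K \in classes -> K' \in classes -> K != K' ->
  C \in K -> D \in K' -> y \in D -> y \notin C.
Proof.
move=> KK KK' KN CK DK yD.
have CD : C != D.
  by apply: contraNneq KN => CD; apply/eqP; apply: class_eq KK KK' CK _; rewrite CD.
by rewrite (disjointFl (covering_disjoint cov (class_Cs KK CK) (class_Cs KK' DK) CD)).
Qed.

(* The chain could follow a lower path, which would merge the two classes. *)
Lemma class_escape K K' C D x y c : K \in classes -> K' \in classes -> K != K' ->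
  C \in K -> D \in K' -> x \in C -> y \in D -> pathLe x y c ->
  exitLevel C <= c /\ minOver C H + g < c.
Proof.
move=> KK KK' KN CK DK xC yD xy.
have yC := class_cycle_notin KK KK' KN CK DK yD.
have Cc := cycle_exitLevel_le e_sym xC yC xy.
have CC := class_Cs KK CK; have DD := class_Cs KK' DK.
have [CS _ _] := classP KK CK; have [DS _ _] := classP KK' DK.
split=> //; rewrite ltNge; apply/negP => cg.
(* Under the contrary assumption the escape level is squeezed between [minOver C H + g] and [c]. *)
have eC : exitLevel C = minOver C H + g.
  apply/le_anti; rewrite (le_trans Cc cg) /= exitLevelE lerD2l; exact: star_depth.
have dC : depth C = g by move: eC; rewrite exitLevelE => /addrI.
have {}xy : pathLe x y (exitLevel C) by apply: pathLe_mono xy; rewrite eC.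
case: (follow_path e_sym e_conn cov CC xC xy) => [|[t Ct tC]|[E ES [CE dE]]].
- rewrite (stateOf_in cov DD yD) => /(class_connect KK CK DS) DK'.
  by case/eqP: KN; exact: class_eq DK' DK.
- have tS := connect_isState e_sym (CC : isState e H Cs (inr C)) Ct.
  have [E ES tE] := flow e_sym e_conn cov tS.
  have EK := class_connect KK CK ES (connect_trans Ct tE).
  have := le_lt_trans (connect_level e_sym tE) tC.
  by rewrite /= (class_exitLevel KK EK CK) ltxx.
- have EK := class_connect KK CK ES CE.
  have EC : E != C by apply: contraTneq dE => ->; rewrite dC ltxx.
  by move: dE; rewrite (class_depth KK EK CK EC) ltxx.
Qed.

(** Each outcome of [follow_path] gives a star cycle other than [C]: the target [D], one with a
    lower escape level, or one of larger depth. *)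
Lemma escape_star C D x y : C \in Cstar -> D \in Cstar -> D != C -> depth C = g ->
  x \in C -> y \in D -> pathLe x y (exitLevel C) ->
  exists2 E, E \in Cstar & (E != C) && reach C E.
Proof.
move=> CS DS DC dC xC yD xy; have CC := star_Cs CS.
case: (follow_path e_sym e_conn cov CC xC xy) => [|[t Ct tC]|[E ES [CE dE]]].
- rewrite (stateOf_in cov (star_Cs DS) yD) => CD.
  by exists D => //; rewrite DC; exact: connect_reach.
- have tS := connect_isState e_sym (CC : isState e H Cs (inr C)) Ct.
  have [E ES tE] := flow e_sym e_conn cov tS.
  exists E => //; rewrite (connect_reach e_sym e_irr CS ES (connect_trans Ct tE)) andbT.
  have := le_lt_trans (connect_level e_sym tE) tC.
  by apply: contraTneq => ->; rewrite ltxx.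
- exists E => //; rewrite (connect_reach e_sym e_irr CS ES CE) andbT.
  by apply: contraTneq dE => ->; rewrite dC ltxx.
Qed.

(** Every class is the reach set of a member different from [C], since a class containing [C] also
    contains [E]. So the star cycles other than [C] already produce all classes. *)
Lemma card_classes_lt C E : C \in Cstar -> E \in Cstar -> E != C -> reach C E ->
  (#|classes| < #|Cstar|)%N.
Proof.
move=> CS ES EC CE; rewrite (cardsD1 C Cstar) CS add1n ltnS.
apply: leq_trans (leq_imset_card (fun D => [set F | reach D F]) _).
apply/subset_leq_card/fintype.subsetP => K KK.
have [D DK] := class_neq0 KK; have [DS KE _] := classP KK DK.
have [DC|DC] := eqVneq D C; last first.
  by apply/imsetP; exists D; rewrite ?in_setD1 ?DC.
have EK : E \in K by rewrite KE inE DC.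
have [_ KE' _] := classP KK EK.
by apply/imsetP; exists E; rewrite ?in_setD1 ?EC.
Qed.

Lemma card_classes_gt0 C : C \in Cstar -> (0 < #|classes|)%N.
Proof. by move=> /reach_class[K KK _]; apply/card_gt0P; exists K. Qed.

End Classes.

(** * Valleys *)

(** What makes the sets V_i disjoint cycles. The sets P_i may be disconnected; [family_pathLe] joins
    their points strictly below the height at which they can be left. *)
Record plateauFamily (R : realType) (T : finType) (e : rel T) (H : T -> R)
    (Ps : {set {set T}}) : Prop := PlateauFamily {
  family_neq0 : forall P, P \in Ps -> exists x, x \in P;
  family_sub : forall P, P \in Ps -> P \subset OmegaBar e H;
  family_disjoint : forall P Q x, P \in Ps -> Q \in Ps -> x \in P -> x \in Q -> P = Q;
  family_two : forall P, P \in Ps -> exists2 Q, Q \in Ps & Q != P;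
  family_H : forall P x, P \in Ps -> x \in P -> H x = HP H P;
  family_pathLe : forall P x y, P \in Ps -> x \in P -> y \in P ->
    exists2 c, c < PhiSet e H P (Pbreve Ps P) & pathLe e H x y c
}.

Section Valleys.
Variables (R : realType) (T : finType) (e : rel T) (H : T -> R).
Hypothesis e_sym : symmetric e.
Hypothesis e_conn : forall x y : T, connect e x y.
Variable Ps : {set {set T}}.
Hypothesis fam : plateauFamily e H Ps.

Local Notation pathLe := (pathLe e H).
Local Notation OmegaBar := (OmegaBar e H).
Local Notation PhiBar := (PhiBar e H).
Local Notation HP := (HP H).
Local Notation Gam := (Gam e H Ps).
Local Notation Vset := (Vset e H Ps).
Implicit Types (x y z w : T) (P Q : {set T}).

(** The absolute height of which [Gam] is the excess over the energy of [P]. *)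
Definition barrier P : R := PhiSet e H P (Pbreve Ps P).

Lemma GamE P : Gam P = barrier P - HP P. Proof. by []. Qed.

Lemma mem_Pbreve P Q y : Q \in Ps -> Q != P -> y \in Q -> y \in Pbreve Ps P.
Proof. by move=> QQ QP yQ; apply/bigcupP; exists Q; rewrite // QQ. Qed.

Lemma barrier_path P : P \in Ps ->
  exists x y Q, [/\ x \in P, y \in Q, Q \in Ps, Q != P & pathLe x y (barrier P)].
Proof.
move=> PP; have [x xP] := family_neq0 fam PP; have [Q QQ QP] := family_two fam PP.
have [y yQ] := family_neq0 fam QQ.
(* The characterisation is applied at the minimal height itself, which extracts an optimal path. *)
have := PhiSet_leP H e_conn (barrier P) xP (mem_Pbreve QQ QP yQ).
rewrite lexx => /elimT -/(_ isT)[u [v [uP /bigcupP[Q' /andP[Q'P QP'] vQ] uv]]].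
by exists u, v, Q'.
Qed.

Lemma barrier_le P Q x y c : Q \in Ps -> Q != P -> x \in P -> y \in Q -> pathLe x y c ->
  barrier P <= c.
Proof.
move=> QQ QP xP yQ xy; have yB := mem_Pbreve QQ QP yQ.
by apply/(PhiSet_leP H e_conn c xP yB); exists x, y.
Qed.

Lemma barrier_PhiBar P : P \in Ps -> barrier P <= PhiBar.
Proof.
move=> PP; have [x xP] := family_neq0 fam PP; have [Q QQ QP] := family_two fam PP.
have [y yQ] := family_neq0 fam QQ; apply: (barrier_le QQ QP xP yQ).
have xO := fintype.subsetP (family_sub fam PP) _ xP.
have yO := fintype.subsetP (family_sub fam QQ) _ yQ.
exact: (OmegaBar_pathLe e_sym e_conn).
Qed.

(** By [family_pathLe], a single base point of [P] can replace the whole set. *)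
Lemma VsetP P x z : P \in Ps -> x \in P ->
  reflect (exists2 c, c < barrier P & pathLe x z c) (z \in Vset P).
Proof.
move=> PP xP; rewrite inE ltrD2r; apply: (iffP idP) => [lt|[c cB xz]].
  have := PhiSet_leP H e_conn (PhiSet e H P [set z]) xP (set11 z).
  rewrite lexx => /elimT -/(_ isT)[u [v [uP /set1P -> uz]]].
  have [c cB xu] := family_pathLe fam PP xP uP.
  exists (Num.max c (PhiSet e H P [set z])); first by rewrite gt_max cB.
  apply: pathLe_trans (pathLe_mono _ xu) (pathLe_mono _ uz); by rewrite le_max lexx ?orbT.
apply: le_lt_trans cB; apply/(PhiSet_leP H e_conn c xP (set11 z)).
by exists x, z; rewrite set11.
Qed.

Lemma family_sub_Vset P : P \in Ps -> P \subset Vset P.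
Proof.
move=> PP; apply/fintype.subsetP => x xP.
by apply/(VsetP x PP xP); exact: family_pathLe.
Qed.

Lemma Vset_other P Q y : P \in Ps -> Q \in Ps -> Q != P -> y \in Q -> y \notin Vset P.
Proof.
move=> PP QQ QP yQ; have [x xP] := family_neq0 fam PP.
apply/negP => /(VsetP y PP xP)[c cB /(barrier_le QQ QP xP yQ)].
by rewrite leNgt cB.
Qed.

Lemma Vset_pathLe P z w : P \in Ps -> z \in Vset P -> w \in Vset P ->
  exists2 c, c < barrier P & pathLe z w c.
Proof.
move=> PP; have [x xP] := family_neq0 fam PP.
move=> /(VsetP z PP xP)[c cB xz] /(VsetP w PP xP)[c' cB' xw].
exists (Num.max c c'); first by rewrite gt_max cB.
apply: pathLe_trans (pathLe_mono _ (pathLe_sym e_sym xz)) (pathLe_mono _ xw);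
  by rewrite le_max lexx ?orbT.
Qed.

Lemma Vset_closed P z w c : P \in Ps -> z \in Vset P -> c < barrier P -> pathLe z w c ->
  w \in Vset P.
Proof.
move=> PP; have [x xP] := family_neq0 fam PP.
move=> /(VsetP z PP xP)[c' cB' xz] cB zw; apply/(VsetP w PP xP).
exists (Num.max c c'); first by rewrite gt_max cB.
apply: pathLe_trans (pathLe_mono _ xz) (pathLe_mono _ zw); by rewrite le_max lexx ?orbT.
Qed.

Lemma Vset_lt P z : P \in Ps -> z \in Vset P -> H z < barrier P.
Proof.
move=> PP zV; have [c cB /pathLe_l Hz] := Vset_pathLe PP zV zV.
exact: le_lt_trans cB.
Qed.

Lemma Vset_bdry P y : P \in Ps -> y \in bdry e (Vset P) -> barrier P <= H y.
Proof.
move=> PP /(bdryP e_sym)[/negP yV [z zV ezy]]; rewrite leNgt; apply/negP => Hy; apply: yV.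
apply: (Vset_closed (c := Num.max (H z) (H y)) PP zV); first by rewrite gt_max Vset_lt.
by apply: pathLe_edge => //; rewrite le_max lexx ?orbT.
Qed.

Lemma Vset_cycle P : P \in Ps -> isCycle e H (Vset P).
Proof.
move=> PP; have [x xP] := family_neq0 fam PP.
have xV := fintype.subsetP (family_sub_Vset PP) _ xP; apply/and3P; split.
- by apply/set0Pn; exists x.
- apply/forall_inP => z zV; apply/forall_inP => w wV.
  have [c cB zw] := Vset_pathLe PP zV wV.
  suff [_ //] : w \in Vset P /\ connect (fun u v => e u v && (v \in Vset P)) z w.
  apply: (pathLe_ind (P := fun w => w \in Vset P /\
    connect (fun u v => e u v && (v \in Vset P)) z w)) zw; first by split; last exact: connect0.
  move=> u v [uV zu] Hu euv Hv.
  have vV : v \in Vset P by apply: (Vset_closed PP uV cB); exact: pathLe_edge.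
  by split=> //; apply: connect_trans zu (connect1 _); rewrite euv.
- apply/forall_inP => z zV; apply/forall_inP => y yV.
  exact: lt_le_trans (Vset_lt PP zV) (Vset_bdry PP yV).
Qed.

(** An optimal path to another member must leave the valley, which gives one inequality; [Vset_bdry]
    gives the other. *)
Lemma Vset_exitLevel P : P \in Ps -> exitLevel e H (Vset P) = barrier P.
Proof.
move=> PP; have [x [y [Q [xP yQ QQ QP xy]]]] := barrier_path PP.
have xV := fintype.subsetP (family_sub_Vset PP) _ xP.
have yV := Vset_other PP QQ QP yQ.
have [w wV Hw] := pathLe_exit e_sym xV yV xy.
apply/le_anti; rewrite (le_trans (minOver_le _ wV) Hw) /= /exitLevel.
by have [v vV ->] := minOver_mem H wV; exact: Vset_bdry.
Qed.

Lemma Vset_OmegaBar P : P \in Ps -> Vset P \subset OmegaBar.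
Proof.
move=> PP; have [x xP] := family_neq0 fam PP.
have xO := fintype.subsetP (family_sub fam PP) _ xP.
apply/fintype.subsetP => z /(VsetP z PP xP)[c cB xz].
apply: (OmegaBar_closed e_conn xO); apply: pathLe_mono xz.
exact: le_trans (ltW cB) (barrier_PhiBar PP).
Qed.

(** A common point joins [P] and [Q] at the larger of two heights, each below the respective
    barrier. Both barriers are then at most this maximum, so each would be strictly below the
    other. *)
Lemma Vset_disjoint P Q z : P \in Ps -> Q \in Ps -> z \in Vset P -> z \in Vset Q -> P = Q.
Proof.
move=> PP QQ; have [x xP] := family_neq0 fam PP; have [y yQ] := family_neq0 fam QQ.
move=> /(VsetP z PP xP)[c cB xz] /(VsetP z QQ yQ)[c' cB' yz].
apply/eqP/negPn/negP => PQ.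
have xy : pathLe x y (Num.max c c').
  apply: pathLe_trans (pathLe_mono _ xz) (pathLe_mono _ (pathLe_sym e_sym yz));
    by rewrite le_max lexx ?orbT.
have := barrier_le PP PQ yQ xP (pathLe_sym e_sym xy).
have := barrier_le QQ _ xP yQ xy; rewrite eq_sym PQ => /(_ isT).
rewrite !le_max [barrier P <= c]leNgt cB [barrier Q <= c']leNgt cB' orbF /= => Pc' Qc.
by have := lt_trans (le_lt_trans Pc' cB') (le_lt_trans Qc cB); rewrite ltxx.
Qed.

(** A lower neighbour of the plateau is reached without climbing above [H z], hence lies in the
    valley and contradicts minimality. *)
Lemma Vset_min_plateau P z : P \in Ps -> z \in Vset P -> (forall w, w \in Vset P -> H z <= H w) ->
  stablePlateau e H (plateau e H z).
Proof.
move=> PP zV zmin; apply: plateau_stable => // y /(bdryP e_sym)[_ [w wP ewy]].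
rewrite leNgt; apply/negP => Hy.
have zy : pathLe z y (H z).
  apply: pathLe_trans (plateau_pathLe wP) _; apply: pathLe_edge => //; last exact: ltW.
  by rewrite (plateau_H wP).
have := zmin _ (Vset_closed PP zV (Vset_lt PP zV) zy).
by rewrite leNgt Hy.
Qed.

End Valleys.

(** * The level invariant *)

(** Here [L] holds the cycles inherited from the previous level, before those meeting a valley are
    discarded. By [inv_separate] an inherited cycle contains no point of any P_i, so it cannot
    contain a valley. *)
Record levelInvariant (R : realType) (T : finType) (e : rel T) (H : T -> R)
    (Ps L : {set {set T}}) : Prop := LevelInvariant {
  inv_family : plateauFamily e H Ps;
  inv_min : forall P z, P \in Ps -> z \in Vset e H Ps P -> HP H P <= H z;
  inv_cycle : forall C, C \in L -> isCycle e H C;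
  inv_sub : forall C, C \in L -> C \subset OmegaBar e H;
  inv_disjoint : forall C D, C \in L -> D \in L -> C != D -> [disjoint C & D];
  inv_depth : forall C, C \in L -> depth e H C < GamStarLvl e H Ps;
  inv_pathLe : forall C, C \in L -> exists x y (P : {set T}),
    [/\ x \in C, y \in P, P \in Ps & pathLe e H x y (exitLevel e H C)];
  inv_separate : forall C P x, C \in L -> P \in Ps -> x \in P -> x \notin C;
  inv_plateau : forall x, x \in OmegaBar e H -> stablePlateau e H (plateau e H x) ->
    (exists2 C, C \in L & x \in C) \/ (exists2 P, P \in Ps & x \in Vset e H Ps P)
}.

Section Level.
Variables (R : realType) (T : finType) (e : rel T) (H : T -> R).
Hypothesis e_sym : symmetric e.
Hypothesis e_irr : irreflexive e.
Hypothesis e_conn : forall x y : T, connect e x y.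
Variables Ps L : {set {set T}}.
Hypothesis inv : levelInvariant e H Ps L.

Let fam : plateauFamily e H Ps := inv_family inv.

Local Notation Vset := (Vset e H Ps).
Local Notation Gam := (Gam e H Ps).
Local Notation CsLvl := (CsLvl e H Ps L).
Local Notation GamStar := (GamStarLvl e H Ps).

Lemma Vset_depth P : P \in Ps -> depth e H (Vset P) = Gam P.
Proof.
move=> PP; rewrite /depth -/(exitLevel e H _) (Vset_exitLevel e_sym e_conn fam PP) GamE.
congr (_ - _); have [x xP] := family_neq0 fam PP.
have xV := fintype.subsetP (family_sub_Vset e_conn fam PP) _ xP.
apply/le_anti; rewrite -{1}(family_H fam PP xP) minOver_le //=.
by have [z zV ->] := minOver_mem H xV; exact: (inv_min inv PP zV).
Qed.

Lemma GamStar_le P : P \in Ps -> GamStar <= Gam P.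
Proof. exact: minOver_le. Qed.

Lemma CsLvlP C : C \in CsLvl ->
  (exists2 P, P \in Ps & C = Vset P) \/
  (C \in L /\ forall P x, P \in Ps -> x \in C -> x \notin Vset P).
Proof.
rewrite inE => /orP[/imsetP[P PP ->]|]; first by left; exists P.
rewrite inE => /andP[CL /forall_inP CN]; right; split=> // P x PP xC.
apply/negP => xV; have /eqP/setP/(_ x) := CN _ PP.
by rewrite in_setI in_set0 xC xV.
Qed.

Lemma mem_CsLvl P : P \in Ps -> Vset P \in CsLvl.
Proof. by move=> PP; rewrite inE imset_f. Qed.

Lemma Vset_inj : {in Ps &, injective Vset}.
Proof.
move=> P Q PP QQ PQ; have [x xP] := family_neq0 fam PP.
have xV := fintype.subsetP (family_sub_Vset e_conn fam PP) _ xP.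
by apply: (Vset_disjoint e_sym e_conn fam PP QQ xV); rewrite -PQ.
Qed.

(** Valleys have depth [Gam], at least the minimum [GamStar]; inherited cycles are shallower. *)
Lemma Cstar_CsLvl : Cstar e H CsLvl GamStar = [set Vset P | P in Ps].
Proof.
apply/setP => C; rewrite inE; apply/andP/imsetP => [[/CsLvlP[[P PP ->]|[CL _]]]|[P PP ->]].
- by exists P.
- by rewrite leNgt (inv_depth inv CL).
- by rewrite mem_CsLvl // Vset_depth // GamStar_le.
Qed.

Lemma covering_level : covering e H CsLvl GamStar.
Proof.
split.
- by move=> C /CsLvlP[[P PP ->]|[CL _]]; [exact: Vset_cycle|exact: (inv_cycle inv)].
- by move=> C /CsLvlP[[P PP ->]|[CL _]]; [exact: Vset_OmegaBar|exact: (inv_sub inv)].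
- move=> C D /CsLvlP[[P PP ->]|[CL CN]] /CsLvlP[[Q QQ ->]|[DL DN]] CD.
  + rewrite disjoint_subset; apply/fintype.subsetP => z zP; rewrite inE; apply/negP => zQ.
    by case/eqP: CD; rewrite (Vset_disjoint e_sym e_conn fam PP QQ zP zQ).
  + rewrite disjoint_sym disjoint_subset; apply/fintype.subsetP => z zD; rewrite inE; exact: DN.
  + rewrite disjoint_subset; apply/fintype.subsetP => z zC; rewrite inE; exact: CN.
  + exact: (inv_disjoint inv).
- move=> C /CsLvlP[[P PP ->]|[CL CN]].
    have [Q QQ QP] := family_two fam PP; exists (Vset Q); first exact: mem_CsLvl.
    by apply: contraNneq QP => /Vset_inj ->.
  have [_ [_ [P [_ _ PP _]]]] := inv_pathLe inv CL; exists (Vset P); first exact: mem_CsLvl.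
  have [x xP] := family_neq0 fam PP.
  have xV := fintype.subsetP (family_sub_Vset e_conn fam PP) _ xP.
  by apply: contraTneq xV => ->; exact: (inv_separate inv CL PP xP).
- move=> x xO xst; have [[C CL xC]|[P PP xV]] := inv_plateau inv xO xst; last first.
    by exists (Vset P) => //; exact: mem_CsLvl.
  have [|/forall_inPn[P PP /set0Pn[z]]] := boolP [forall P in Ps, C :&: Vset P == finset.set0].
    by move=> CN; exists C => //; rewrite !inE CL CN orbT.
  rewrite in_setI => /andP[zC zV]; exists (Vset P); first exact: mem_CsLvl.
  have VC := Vset_cycle e_sym e_conn fam PP.
  (* The discarded cycle is nested with the valley it meets. It lies inside the valley, as the
     reverse inclusion would put points of [P] in [C]. *)
  have [/fintype.subsetP|/fintype.subsetP VsC] := cycles_nested e_sym (inv_cycle inv CL) VC zC zV.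
    by apply.
  have [y yP] := family_neq0 fam PP.
  have yV := fintype.subsetP (family_sub_Vset e_conn fam PP) _ yP.
  by have := inv_separate inv CL PP yP; rewrite VsC.
- move=> C; rewrite inE => /andP[/CsLvlP[[P PP ->]|[CL CN] _]].
    by rewrite Vset_depth // ltNge GamStar_le.
  have [x [y [P [xC yP PP xy]]]] := inv_pathLe inv CL; exists x, y, (Vset P); split=> //.
    exact: (fintype.subsetP (family_sub_Vset e_conn fam PP)).
  by rewrite Cstar_CsLvl imset_f.
Qed.

(** A minimiser of [Gam] has a valley of depth exactly [GamStar]; [escape_star] along an optimal
    path out of it gives the pair required by [card_classes_lt]. *)
Lemma card_classesLvl_lt : (0 < #|Ps|)%N -> (#|classesLvl e H Ps L| < #|Ps|)%N.
Proof.
move=> /card_gt0P[P0 P0P]; have [P PP PE] := minOver_mem Gam P0P.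
have dP : depth e H (Vset P) = GamStar by rewrite Vset_depth.
have [x [y [Q [xP yQ QQ QP xy]]]] := barrier_path e_conn fam PP.
have VP : Vset P \in Cstar e H CsLvl GamStar by rewrite Cstar_CsLvl imset_f.
have VQ : Vset Q \in Cstar e H CsLvl GamStar by rewrite Cstar_CsLvl imset_f.
have VN : Vset Q != Vset P by apply: contraNneq QP => /Vset_inj ->.
have xV := fintype.subsetP (family_sub_Vset e_conn fam PP) _ xP.
have yV := fintype.subsetP (family_sub_Vset e_conn fam QQ) _ yQ.
rewrite -(Vset_exitLevel e_sym e_conn fam PP) in xy.
have [E ES /andP[EN PE']] := escape_star e_sym e_irr e_conn covering_level VP VQ VN dP xV yV xy.
have := card_classes_lt VP ES EN PE'.
by rewrite Cstar_CsLvl card_in_imset //; exact: Vset_inj.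
Qed.

Lemma card_classesLvl_gt0 : (0 < #|Ps|)%N -> (0 < #|classesLvl e H Ps L|)%N.
Proof.
move=> /card_gt0P[P PP]; apply: (@card_classes_gt0 _ _ _ _ _ _ (Vset P)).
by rewrite Cstar_CsLvl imset_f.
Qed.

End Level.

(** * Passage of the invariant to the next level *)

Section NextLevel.
Variables (R : realType) (T : finType) (e : rel T) (H : T -> R).
Hypothesis e_sym : symmetric e.
Hypothesis e_irr : irreflexive e.
Hypothesis e_conn : forall x y : T, connect e x y.
Variables (Cs : {set {set T}}) (g : R).
Hypothesis cov : covering e H Cs g.

Local Notation exitLevel := (exitLevel e H).
Local Notation classes := (closedClasses e H Cs g).
Implicit Types (x y z : T) (C D : {set T}) (K : {set {set T}}).

Definition bottom K : {set T} := \bigcup_(C in K) Fmin H C.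

Local Notation Ps := (bottom @: classes).
Local Notation L := (Ctr e H Cs g :|: Csharp e H Cs g).
Local Notation Vset := (Vset e H Ps).
Local Notation barrier := (barrier e H Ps).

Lemma mem_bottom K C x : C \in K -> x \in Fmin H C -> x \in bottom K.
Proof. by move=> CK xC; apply/bigcupP; exists C. Qed.

Lemma bottomP K x : x \in bottom K ->
  exists2 C, C \in K & (x \in C) /\ H x = minOver C H.
Proof.
by move=> /bigcupP[C CK]; rewrite mem_Fmin => /andP[xC /eqP Hx]; exists C.
Qed.

Lemma Fmin_neq0 C : C \in Cs -> exists2 x, x \in Fmin H C & x \in C.
Proof.
move=> /(covering_cycle cov)/cycle_neq0[x xC]; have [y yC yE] := minOver_mem H xC.
by exists y; rewrite // mem_Fmin yC yE eqxx.
Qed.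

Lemma bottom_disjoint K K' x : K \in classes -> K' \in classes ->
  x \in bottom K -> x \in bottom K' -> K = K'.
Proof.
move=> KK KK' /bottomP[C CK [xC _]] /bottomP[D DK [xD _]].
apply/eqP/negPn/negP => KN.
by have := class_cycle_notin cov KK KK' KN CK DK xD; rewrite xC.
Qed.

Lemma bottom_neq0 K : K \in classes -> exists x, x \in bottom K.
Proof.
move=> KK; have [C CK] := class_neq0 KK; have [x xC _] := Fmin_neq0 (class_Cs KK CK).
by exists x; exact: mem_bottom xC.
Qed.

Lemma bottom_inj : {in classes &, injective bottom}.
Proof.
move=> K K' KK KK' KE; have [x xK] := bottom_neq0 KK.
by apply: (bottom_disjoint KK KK' xK); rewrite -KE.
Qed.

Lemma card_bottoms : #|Ps| = #|classes|.
Proof. by rewrite card_in_imset //; exact: bottom_inj. Qed.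

Lemma bottom_H K C x : K \in classes -> C \in K -> x \in bottom K -> H x = minOver C H.
Proof. by move=> KK CK /bottomP[D DK [_ ->]]; exact: (class_minOver e_sym KK DK CK). Qed.

Lemma HP_bottom K C : K \in classes -> C \in K -> HP H (bottom K) = minOver C H.
Proof.
move=> KK CK; rewrite /HP; have [x xK] := bottom_neq0 KK.
by have [y yK ->] := minOver_mem H xK; exact: bottom_H yK.
Qed.

Hypothesis two : (2 <= #|classes|)%N.

Lemma other_class K : K \in classes -> exists2 K', K' \in classes & K' != K.
Proof.
move=> KK; move: two; rewrite (cardsD1 K) KK ltnS => /card_gt0P[K'].
by rewrite !in_setD1 => /andP[KN KK']; exists K'.
Qed.

(** An optimal path out of the bottom of [K] ends in another class, so [class_escape] applies to the
    cycle where it starts; escape level and bottom energy are common to the whole class. *)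
Lemma bottom_barrier K C : K \in classes -> C \in K ->
  exitLevel C <= barrier (bottom K) /\ minOver C H + g < barrier (bottom K).
Proof.
move=> KK CK; have [x0 x0K] := bottom_neq0 KK; have [K0 KK0 KN0] := other_class KK.
have [y0 y0K] := bottom_neq0 KK0.
have y0B : y0 \in Pbreve Ps (bottom K).
  apply: mem_Pbreve y0K; first exact: imset_f.
  by apply: contraNneq KN0 => /bottom_inj ->.
have := PhiSet_leP H e_conn (barrier (bottom K)) x0K y0B.
rewrite lexx => /elimT -/(_ isT)[x [y [xK /bigcupP[Q /andP[/imsetP[K' KK' ->] QN] yQ] xy]]].
have KN : K != K' by apply: contraNneq QN => ->.
have [D DK [xD _]] := bottomP xK; have [D' DK' [yD _]] := bottomP yQ.
have := class_escape e_sym e_irr e_conn cov KK KK' KN DK DK' xD yD xy.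
by rewrite (class_exitLevel e_sym KK DK CK) (class_minOver e_sym KK DK CK).
Qed.

Lemma bottom_family : plateauFamily e H Ps.
Proof.
split.
- by move=> _ /imsetP[K KK ->]; exact: bottom_neq0.
- move=> _ /imsetP[K KK ->]; apply/fintype.subsetP => x /bottomP[C CK [xC _]].
  exact: (fintype.subsetP (covering_sub cov (class_Cs KK CK))).
- by move=> _ _ x /imsetP[K KK ->] /imsetP[K' KK' ->] xK /(bottom_disjoint KK KK' xK) ->.
- move=> _ /imsetP[K KK ->]; have [K' KK' KN] := other_class KK.
  exists (bottom K'); first exact: imset_f.
  by apply: contraNneq KN => /bottom_inj ->.
- move=> _ x /imsetP[K KK ->] xK; have [C CK] := class_neq0 KK.
  by rewrite (HP_bottom KK CK) (bottom_H KK CK xK).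
- move=> _ x y /imsetP[K KK ->] /bottomP[C CK [xC _]] /bottomP[D DK [yD _]].
  have [le_bar lt_bar] := bottom_barrier KK CK; have CC := class_Cs KK CK.
  (* Strictness has two sources: for distinct cycles the depth is [g] and the barrier exceeds
     [minOver C H + g]; within one cycle the path stays strictly below the escape level. *)
  have [CD|CD] := eqVneq C D; last first.
    exists (exitLevel C); last exact: (class_pathLe e_sym e_conn cov KK CK DK xC yD).
    by rewrite exitLevelE (class_depth e_sym KK CK DK CD).
  rewrite -CD in yD; have [z _ zC] := cycle_complement cov CC.
  have [c cC xy] := cycle_pathLe e_sym e_conn (covering_cycle cov CC) xC yD zC.
  by exists c => //; exact: lt_le_trans le_bar.
Qed.

Lemma class_sub_Vset K C : K \in classes -> C \in K -> C \subset Vset (bottom K).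
Proof.
move=> KK CK; have [le_bar _] := bottom_barrier KK CK; have CC := class_Cs KK CK.
have [y yF yC] := Fmin_neq0 CC; apply/fintype.subsetP => x xC.
apply/(VsetP e_conn bottom_family x (imset_f _ KK) (mem_bottom CK yF)).
have [z _ zC] := cycle_complement cov CC.
have [c cC xy] := cycle_pathLe e_sym e_conn (covering_cycle cov CC) yC xC zC.
by exists c => //; exact: lt_le_trans le_bar.
Qed.

(* A lower point of the valley would lie in a cycle from which the chain, staying inside the
   valley, flows into [K] below the escape level of [K]. *)
Lemma bottom_min K z : K \in classes -> z \in Vset (bottom K) -> HP H (bottom K) <= H z.
Proof.
move=> KK zV; have PP : bottom K \in Ps by exact: imset_f.
have [z0 z0V z0E] := minOver_mem H zV.
have z0min w : w \in Vset (bottom K) -> H z0 <= H w by move=> wV; rewrite -z0E minOver_le.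
apply: le_trans (z0min _ zV); rewrite leNgt; apply/negP => lo.
have fam := bottom_family.
have z0O := fintype.subsetP (Vset_OmegaBar e_sym e_conn fam PP) _ z0V.
have [C CC z0C] := covering_plateau cov z0O (Vset_min_plateau e_sym e_conn fam PP z0V z0min).
have [B BK] := class_neq0 KK; have [_ lt_bar] := bottom_barrier KK BK.
rewrite (HP_bottom KK BK) in lo.
have minC : minOver C H <= H z0 by exact: minOver_le.
have [dC|dC] := leP (depth e H C) g.
  have [K' KK' [D DK CD]] := flow_class e_sym e_conn cov (CC : isState e H Cs (inr C)).
  have lvl_lt : exitLevel C < minOver B H + g.
    by rewrite exitLevelE; apply: ltr_leD => //; exact: le_lt_trans lo.
  have [y yF yD] := Fmin_neq0 (class_Cs KK' DK).
  have zy := connect_pathLe e_sym e_conn cov (s := inr C) (t := inr D) CC CD z0C yD.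
  have yV := Vset_closed e_conn fam PP z0V (lt_trans lvl_lt lt_bar) zy.
  have KE : K' = K.
    apply/eqP/negPn/negP => KN.
    have : bottom K' != bottom K by apply: contraNneq KN => /bottom_inj ->.
    move=> /(Vset_other e_conn fam PP (imset_f _ KK')) /(_ (mem_bottom DK yF)).
    by rewrite yV.
  rewrite {}KE in KK' DK.
  have := le_lt_trans (connect_level e_sym CD) lvl_lt.
  rewrite /= (class_exitLevel e_sym KK DK BK) exitLevelE ltrD2l ltNge.
  by have [/star_depth -> _ _] := classP KK BK.
(* A cycle deeper than [g] cannot be left, so it belongs to a closed class. The valley of that class
   shares [z0] with the one of [K], so the class is [K] and the bottoms agree. *)
have CS : C \in Cstar e H Cs g by rewrite inE CC ltW.
have [K' KK' [D DK CD]] := reach_class CS.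
have DC : D = C.
  apply/eqP/negPn/negP => DC.
  by have := connect_shallow e_sym CC (reach_connect CD) DC; rewrite leNgt dC.
rewrite {}DC in DK.
have z0V' := fintype.subsetP (class_sub_Vset KK' DK) _ z0C.
have KE := bottom_inj KK' KK (Vset_disjoint e_sym e_conn fam (imset_f _ KK') PP z0V' z0V).
rewrite KE in DK; move: lo; rewrite (class_minOver e_sym KK BK DK).
by rewrite ltNge minC.
Qed.

(** The threshold strictly increases, so transient cycles, of depth at most [g], become sharp like
    the old sharp ones. *)
Lemma GamStar_bottom : g < GamStarLvl e H Ps.
Proof.
have /card_gt0P[K KK] : (0 < #|classes|)%N by exact: ltnW.
have := minOver_mem (Gam e H Ps) (imset_f bottom KK).
rewrite /GamStarLvl => -[_ /imsetP[K' KK' ->] ->].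
have [B BK] := class_neq0 KK'; rewrite GamE (HP_bottom KK' BK) ltrBrDl.
by have [] := bottom_barrier KK' BK.
Qed.

Lemma nextL_Cs C : C \in L -> C \in Cs.
Proof. by rewrite in_setU => /orP[]; rewrite inE => /andP[] // /star_Cs. Qed.

Lemma nextL_notin C K D : C \in L -> K \in classes -> D \in K -> D != C.
Proof.
rewrite in_setU => /orP[]; rewrite inE => /andP[].
  by move=> _ /forall_inP CN KK DK; apply: contraTneq DK => ->; exact: CN.
move=> _ dC KK DK; have [DS _ _] := classP KK DK.
by apply: contraTneq dC => <-; rewrite -leNgt (star_depth DS).
Qed.

Lemma next_invariant : levelInvariant e H Ps L.
Proof.
split.
- exact: bottom_family.
- by move=> _ z /imsetP[K KK ->]; exact: bottom_min.
- by move=> C /nextL_Cs; exact: (covering_cycle cov).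
- by move=> C /nextL_Cs; exact: (covering_sub cov).
- by move=> C D /nextL_Cs CC /nextL_Cs; exact: (covering_disjoint cov CC).
- move=> C; rewrite in_setU => /orP[/(transient_depth e_sym) dC|].
    exact: le_lt_trans GamStar_bottom.
  by rewrite inE => /andP[_ dC]; exact: lt_trans GamStar_bottom.
- move=> C /nextL_Cs CC.
  (* The flow from [C] into a closed class yields a path to a set of the new family below the escape
     level of [C]. *)
  have [K KK [D DK CD]] := flow_class e_sym e_conn cov (CC : isState e H Cs (inr C)).
  have [x _ xC] := Fmin_neq0 CC; have [y yF yD] := Fmin_neq0 (class_Cs KK DK).
  exists x, y, (bottom K); split=> //; [exact: mem_bottom yF|exact: imset_f|].
  exact: (connect_pathLe e_sym e_conn cov (s := inr C) (t := inr D) CC CD xC yD).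
- move=> C _ x CL /imsetP[K KK ->] /bottomP[D DK [xD _]].
  have DC := nextL_notin CL KK DK.
  by rewrite (disjointFr (covering_disjoint cov (class_Cs KK DK) (nextL_Cs CL) DC)).
- move=> x xO xst; have [C CC xC] := covering_plateau cov xO xst.
  have [|CN] := boolP (C \in L); first by left; exists C.
  have [K KK CK] : exists2 K, K \in classes & C \in K.
    move: CN; rewrite in_setU negb_or !inE CC /= -leNgt => /andP[CN dC].
    move: CN; rewrite dC /= => /forall_inPn[K KK /negbNE CK]; exists K => //.
  right; exists (bottom K); first exact: imset_f.
  exact: (fintype.subsetP (class_sub_Vset KK CK)).
Qed.

End NextLevel.

(** * The first level: stable plateaux *)

Section FirstLevel.
Variables (R : realType) (T : finType) (e : rel T) (H : T -> R).
Hypothesis e_sym : symmetric e.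
Hypothesis e_conn : forall x y : T, connect e x y.
Hypothesis two : (2 <= #|P1 e H|)%N.

Local Notation P1 := (P1 e H).

Lemma P1_stable P : P \in P1 -> stablePlateau e H P.
Proof. by rewrite inE => /andP[]. Qed.

Lemma P1_H P x : P \in P1 -> x \in P -> H x = HP H P.
Proof.
move=> /P1_stable sP xP; rewrite /HP; have [y yP ->] := minOver_mem H xP.
by case: (stablePlateau_pathLe sP xP yP).
Qed.

Lemma P1_disjoint P Q x : P \in P1 -> Q \in P1 -> x \in P -> x \in Q -> P = Q.
Proof.
move=> /P1_stable sP /P1_stable sQ xP xQ; apply/setP => y; apply/idP/idP => yP.
  by apply: (stablePlateau_stay e_sym sQ xQ); case: (stablePlateau_pathLe sP xP yP).
by apply: (stablePlateau_stay e_sym sP xP); case: (stablePlateau_pathLe sQ xQ yP).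
Qed.

Lemma P1_family : plateauFamily e H P1.
Proof.
have neq0 P : P \in P1 -> exists x, x \in P.
  by move=> /P1_stable/and4P[/set0Pn].
have other P : P \in P1 -> exists2 Q, Q \in P1 & Q != P.
  move=> PP; move: two; rewrite (cardsD1 P) PP ltnS => /card_gt0P[Q].
  by rewrite in_setD1 => /andP[QN QQ]; exists Q.
split=> //.
- by move=> P; rewrite inE => /andP[].
- exact: P1_disjoint.
- exact: P1_H.
- move=> P x y PP xP yP; have [_ xy] := stablePlateau_pathLe (P1_stable PP) xP yP.
  (* The plateau energy is strictly below the barrier, since no path at that height leaves a stable
     plateau. *)
  exists (H x) => //; have [Q QQ QP] := other _ PP; have [q qQ] := neq0 _ QQ.
  rewrite ltNge; apply/negP => /(PhiSet_leP H e_conn _ xP (mem_Pbreve QQ QP qQ)).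
  move=> [u [v [uP /bigcupP[Q' /andP[QQ' QP'] vQ] uv]]].
  have {}uv : pathLe e H u v (H u) by rewrite (P1_H PP uP) -(P1_H PP xP).
  have vP := stablePlateau_stay e_sym (P1_stable PP) uP uv.
  by case/eqP: QP'; exact: P1_disjoint vQ vP.
Qed.

Lemma plateau_P1 x : x \in OmegaBar e H -> stablePlateau e H (plateau e H x) ->
  plateau e H x \in P1.
Proof. by move=> xO xst; rewrite inE xst plateau_OmegaBar. Qed.

Lemma first_invariant : levelInvariant e H P1 finset.set0.
Proof.
have fam := P1_family.
split=> //; try by move=> C; rewrite inE.
- move=> P z PP zV; have [z0 z0V z0E] := minOver_mem H zV.
  have z0min w : w \in Vset e H P1 P -> H z0 <= H w by move=> wV; rewrite -z0E minOver_le.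
  apply: le_trans (z0min _ zV).
  have z0O := fintype.subsetP (Vset_OmegaBar e_sym e_conn fam PP) _ z0V.
  (* The plateau of a lowest point of the valley is itself a member of the family; were it not [P],
     it could not meet the valley of [P]. *)
  have QQ := plateau_P1 z0O (Vset_min_plateau e_sym e_conn fam PP z0V z0min).
  have [QP|QP] := eqVneq (plateau e H z0) P.
    by rewrite -(P1_H PP (x := z0)) // -QP plateau_self.
  by have := Vset_other e_conn fam PP QQ QP (plateau_self e H z0); rewrite z0V.
- move=> x xO xst; right; exists (plateau e H x); first exact: plateau_P1.
  apply: (fintype.subsetP (family_sub_Vset e_conn fam (plateau_P1 xO xst))).
  exact: plateau_self.
Qed.

End FirstLevel.

(** * Strict decrease and termination *)

Section Hierarchy.
Variables (R : realType) (T : finType) (e : rel T) (H : T -> R).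
Hypothesis e_sym : symmetric e.
Hypothesis e_irr : irreflexive e.
Hypothesis e_conn : forall x y : T, connect e x y.

(** Indices are shifted: [lvl h] carries the data of level h+1, whose sets number [nu h]. The
    assumption says that this level is defined. *)
Lemma lvl_invariant h : (forall k, (k <= h)%N -> (2 <= nu e H k)%N) ->
  levelInvariant e H (lvl e H h).1 (lvl e H h).2 /\ #|(lvl e H h).1| = nu e H h.
Proof.
elim: h => [|h IH] nu2; first by split=> //; exact: first_invariant (nu2 0%N _).
have [|inv _] := IH; first by move=> k kh; apply: nu2; exact: leqW.
have cov := covering_level e_sym e_conn inv.
have two := nu2 h.+1 (leqnn _).
split; first exact: (next_invariant e_sym e_irr e_conn cov two).
exact: (card_bottoms cov).
Qed.

Lemma nu_step h : (forall k, (k <= h)%N -> (2 <= nu e H k)%N) ->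
  (0 < nu e H h.+1 < nu e H h)%N.
Proof.
move=> nu2; have [inv cardPs] := lvl_invariant nu2.
have pos : (0 < #|(lvl e H h).1|)%N by rewrite cardPs; exact/ltnW/nu2.
rewrite -cardPs /nu card_classesLvl_gt0 //=; exact: card_classesLvl_lt.
Qed.

End Hierarchy.

Theorem mainTheorem6 (R : realType) (T : finType) (e : rel T) (H : T -> R)
  (e_sym : symmetric e) (e_irr : irreflexive e)
  (e_conn : forall x y : T, connect e x y)
  (nu0 : (2 <= nu e H 0)%N) :
  (forall h : nat, (1 <= h)%N ->
     (forall k : nat, (k < h)%N -> (2 <= nu e H k)%N) ->
     (nu e H h < nu e H h.-1)%N) /\
  (exists m : nat, [/\ (1 <= m)%N, (forall k : nat, (k < m)%N -> (2 <= nu e H k)%N),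
                       (1 < nu e H m.-1)%N & nu e H m = 1%N]).
Proof.
split=> [[//|h] _ nu2|]; first by case/andP: (nu_step e_sym e_irr e_conn nu2).
have [m lt2 m_min] : exists2 m, (nu e H m < 2)%N & forall k, (nu e H k < 2)%N -> (m <= k)%N.
  have ex2 : exists m, (nu e H m < 2)%N; last by case: (ex_minnP ex2) => m; exists m.
  apply: contrapT => none.
  have nu2 k : (2 <= nu e H k)%N by rewrite leqNgt; apply/negP => lt2; apply: none; exists k.
  (* If all values were at least 2, every step would lose at least one, which is impossible after
     [nu 0] + 1 steps. *)
  have bound h : (nu e H h + h <= nu e H 0)%N.
    elim: h => [|h IH]; first by rewrite addn0.
    have /andP[_ lt] := nu_step e_sym e_irr e_conn (h := h) (fun k _ => nu2 k).
    by apply: leq_trans IH; rewrite addnS -addSn leq_add2r.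
  have := leq_trans (leq_addl _ _) (bound (nu e H 0).+1).
  by rewrite ltnn.
have nu2 k : (k < m)%N -> (2 <= nu e H k)%N.
  by move=> km; rewrite leqNgt; apply/negP => /m_min; rewrite leqNgt km.
case: m lt2 nu2 {m_min} => [|m] lt2 nu2; first by rewrite ltnNge nu0 in lt2.
exists m.+1; split=> //; first exact: nu2.
(* At the first index with value below 2, positivity of the number of closed classes leaves only the
   value 1. *)
by case/andP: (nu_step e_sym e_irr e_conn nu2) => pos _; apply/eqP; rewrite eqn_leq -ltnS lt2.
Qed.
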